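(* Let $\mathbf W=\{W^n\}_{n\ge1}$ be a general sequence of channels with $W^n$ a channel from $\mathcal X^n$ to $\mathcal Y^n$, where $|\mathcal X^n|=d^n$ for a fixed positive integer $d$. Then for every real $0\le\epsilon<1$, $$\sup_{\mathbf p}\underline I(\epsilon|\mathbf p,\mathbf W)\le D(1-\epsilon,0|\mathbf W)\le S^\dagger(\epsilon|\mathbf W)\le\sup_{\mathbf p}\underline I(\tfrac{\epsilon}{2}|\mathbf p,\mathbf W),$$ $$\sup_{\mathbf p}\overline I(\epsilon|\mathbf p,\mathbf W)\le D^\dagger(1-\epsilon,0|\mathbf W)\le S(\epsilon|\mathbf W)\le\sup_{\mathbf p}\overline I(\tfrac{\epsilon}{2}|\mathbf p,\mathbf W).$$ Moreover the first inequality of each chain (between $\sup_{\mathbf p}\underline I$ resp. $\sup_{\mathbf p}\overline I$ and $D$ resp. $D^\dagger$) holds for all $0\le\epsilon\le1$, and the last inequalities $S^\dagger(\epsilon|\mathbf W)\le\sup_{\mathbf p}\underline I(\epsilon/2|\mathbf p,\mathbf W)$ and $S(\epsilon|\mathbf W)\le\sup_{\mathbf p}\overline I(\epsilon/2|\mathbf p,\mathbf W)$ hold for all $0\le\epsilon\le2$. In particular, $$\sup_{\mathbf p}\underline I(0|\mathbf p,\mathbf W)=D(1,0|\mathbf W)=S^\dagger(0|\mathbf W),\qquad \sup_{\mathbf p}\overline I(0|\mathbf p,\mathbf W)=D^\dagger(1,0|\mathbf W)=S(0|\mathbf W).$$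
   Context: A channel $W$ from a finite set $\mathcal X$ to a countable set $\mathcal Y$ assigns to each $x$ a distribution $W_x$ on $\mathcal Y$; $W_p(y)=\sum_xp(x)W_x(y)$. An identification code $\Phi=(N,\{Q_i\}_{i=1}^N,\{\mathcal D_i\}_{i=1}^N)$ consists of distributions $Q_i$ on the input set and (not necessarily disjoint) subsets $\mathcal D_i$ of the output set, with $|\Phi|=N$, $\mu(\Phi)=\max_iW_{Q_i}(\mathcal D_i^c)$, $\lambda(\Phi)=\max_{i\neq j}W_{Q_j}(\mathcal D_i)$. A resolvability code $\Psi$ of size $M$ is a tuple $(x_1,\dots,x_M)$ of inputs, with $\epsilon(\Psi,W_p):=\sum_y|\frac1M\sum_iW_{x_i}(y)-W_p(y)|$, and for real $M>0$, $\epsilon(M,W):=\max_p\min_{\Psi:|\Psi|\le M}\epsilon(\Psi,W_p)$ (max over all distributions $p$ on the input set). Capacities: $D(\mu,\lambda|\mathbf W):=\sup\{\liminf_n\frac1n\log\log|\Phi_n|\}$ over sequences $\{\Phi_n\}$ of identification codes for $W^n$ with $\limsup_n\mu(\Phi_n)<\mu$ and $\limsup_n\lambda(\Phi_n)\le\lambda$; $D^\dagger(\mu,\lambda|\mathbf W)$ is the same with $\liminf_n\mu(\Phi_n)<\mu$ in place of $\limsup_n\mu(\Phi_n)<\mu$; when $\mu=0$ these conditions are replaced by $\limsup_n\mu(\Phi_n)=0$, resp. $\liminf_n\mu(\Phi_n)=0$. $S(\epsilon|\mathbf W):=\sup\{R:\limsup_n\epsilon(e^{nR},W^n)\le\epsilon\}$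 and $S^\dagger(\epsilon|\mathbf W):=\sup\{R:\liminf_n\epsilon(e^{nR},W^n)\le\epsilon\}$; for $\epsilon=2$, ''$\le\epsilon$'' is replaced by ''$<2$''. For a sequence $\mathbf p=\{p^n\}$ of distributions $p^n$ on $\mathcal X^n$: $\overline I(\epsilon|\mathbf p,\mathbf W):=\inf\{a:\limsup_n\mathrm{E}_{p^n}W^n_x\{y:\frac1n\log\frac{W^n_x(y)}{W^n_{p^n}(y)}>a\}\le\epsilon\}$ and $\underline I(\epsilon|\mathbf p,\mathbf W):=\inf\{a:\liminf_n\mathrm{E}_{p^n}W^n_x\{y:\frac1n\log\frac{W^n_x(y)}{W^n_{p^n}(y)}>a\}\le\epsilon\}$; for $\epsilon=1$, ''$\le\epsilon$'' is replaced by ''$<1$''. Suprema over $\mathbf p$ range over all such sequences.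
   Formalization: S and S† are taken as the infimum (not the supremum) of the rates R with limsup, resp. liminf, of ε(e^{nR},W^n) at most ε, since the supremum is always +∞; and log log 1 is read as 0, so a one-message identification code has rate 0. *)

(* Defs.v *)
From HB Require Import structures.
From mathcomp Require Import all_boot all_order all_algebra.
From mathcomp Require Import all_classical all_reals all_analysis.
Set Implicit Arguments. Unset Strict Implicit. Unset Printing Implicit Defensive.
Import Order.TTheory GRing.Theory Num.Theory.
Local Open Scope classical_set_scope.
Local Open Scope ring_scope.

Section Channels.
Variable R : realType.

Definition is_fdist (T : finType) (p : T -> R) : Prop :=
  (forall x, 0 <= p x) /\ \sum_(x : T) p x = 1.

Definition is_dist (T : countType) (q : T -> R) : Prop :=
  (forall y, 0 <= q y) /\ (\esum_(y in [set: T]) (q y)%:E = 1)%E.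

Definition prob (T : countType) (q : T -> R) (A : set T) : \bar R :=
  \esum_(y in A) (q y)%:E.

Definition is_channel (X : finType) (Y : countType) (W : X -> Y -> R) : Prop :=
  forall x, is_dist (W x).

Definition outdist (X : finType) (Y : countType) (W : X -> Y -> R) (p : X -> R)
  : Y -> R := fun y => \sum_(x : X) p x * W x y.

Record idcode (X : finType) (Y : countType) := IdCode {
  idN : nat;
  idQ : 'I_idN -> X -> R;
  idD : 'I_idN -> set Y }.
Arguments idN {X Y} i : rename.
Arguments idQ {X Y} i _ _ : rename.
Arguments idD {X Y} i _ _ : rename.

Definition is_idcode (X : finType) (Y : countType) (c : idcode X Y) : Prop :=
  (0 < idN c)%N /\ forall i, is_fdist (idQ c i).

Definition id_mu (X : finType) (Y : countType) (W : X -> Y -> R) (c : idcode X Y)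
  : \bar R :=
  \big[maxe/0%E]_(i < idN c) prob (outdist W (idQ c i)) (~` idD c i).

(* lambda(Phi) = max_{i <> j} W_{Q_j}(D_i)  (= 0 when N = 1) *)
Definition id_lambda (X : finType) (Y : countType) (W : X -> Y -> R) (c : idcode X Y)
  : \bar R :=
  \big[maxe/0%E]_(i < idN c) \big[maxe/0%E]_(j < idN c | j != i)
     prob (outdist W (idQ c j)) (idD c i).

Definition idrate (n N : nat) : \bar R := ((n%:R)^-1 * ln (ln N%:R))%:E.

Definition ID_cap (lim : (nat -> \bar R) -> \bar R)
  (X : nat -> finType) (Y : nat -> countType) (W : forall n, X n -> Y n -> R)
  (mu lam : R) : \bar R :=
  ereal_sup [set r | exists c : forall n, idcode (X n) (Y n),
    (forall n, is_idcode (c n)) /\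
    (if mu == 0 then lim (fun n => id_mu (W n) (c n)) = 0%E
     else (lim (fun n => id_mu (W n) (c n)) < mu%:E)%E) /\
    (limn_esup (fun n => id_lambda (W n) (c n)) <= lam%:E)%E /\
    r = limn_einf (fun n => idrate n (idN (c n)))].

Definition Dcap := ID_cap limn_esup.
Definition Dcap_dag := ID_cap limn_einf.

(* epsilon(Psi, q) for a resolvability code Psi = s = (x_1,...,x_M) *)
Definition res_err (X : finType) (Y : countType) (W : X -> Y -> R) (s : seq X)
  (q : Y -> R) : \bar R :=
  \esum_(y in [set: Y]) (`| (size s)%:R^-1 * \sum_(x <- s) W x y - q y |)%:E.

Definition eps_res (X : finType) (Y : countType) (W : X -> Y -> R) (M : R)
  : \bar R :=
  ereal_sup [set e | exists p : X -> R, is_fdist p /\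
    e = ereal_inf [set res_err W s (outdist W p) |
                   s in [set s : seq X | (0 < size s)%N /\ (size s)%:R <= M]]].

Definition Res_cap (lim : (nat -> \bar R) -> \bar R)
  (X : nat -> finType) (Y : nat -> countType) (W : forall n, X n -> Y n -> R)
  (eps : R) : \bar R :=
  ereal_inf [set r%:E | r in [set r : R |
    if eps == 2 then (lim (fun n => eps_res (W n) (expR (n%:R * r))) < 2%:E)%E
    else (lim (fun n => eps_res (W n) (expR (n%:R * r))) <= eps%:E)%E]].

Definition Scap := Res_cap limn_esup.
Definition Scap_dag := Res_cap limn_einf.

Definition info_tail (X : finType) (Y : countType) (W : X -> Y -> R) (p : X -> R)
  (n : nat) (a : R) : \bar R :=
  (\sum_(x : X) (p x)%:E *
     prob (W x) [set y | (a < (n%:R)^-1 * ln (W x y / outdist W p y))%R])%E.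

Definition I_cap (lim : (nat -> \bar R) -> \bar R)
  (X : nat -> finType) (Y : nat -> countType) (W : forall n, X n -> Y n -> R)
  (p : forall n, X n -> R) (eps : R) : \bar R :=
  ereal_inf [set a%:E | a in [set a : R |
    if eps == 1 then (lim (fun n => info_tail (W n) (p n) n a) < 1%E)%E
    else (lim (fun n => info_tail (W n) (p n) n a) <= eps%:E)%E]].

Definition Iup := I_cap limn_esup.
Definition Ilow := I_cap limn_einf.

Definition supI (Icap : forall (X : nat -> finType) (Y : nat -> countType),
                   (forall n, X n -> Y n -> R) -> (forall n, X n -> R) -> R -> \bar R)
  (X : nat -> finType) (Y : nat -> countType) (W : forall n, X n -> Y n -> R)
  (eps : R) : \bar R :=
  ereal_sup [set Icap X Y W p eps |
             p in [set p : forall n, X n -> R | forall n, is_fdist (p n)]].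

End Channels.

(* Main.v *)
(* For an input law p and a threshold C = e^(na), let T_x be the set of outputs
   y with W_x(y) > C W_p(y).  Then W_p(T_x) <= 1/C for every x, while the
   average of W_x(T_x) under p is the tail probability J of the information
   spectrum at a.

   Identification from information.  Draw M slightly smaller than C inputs
   independently from p, encode a message by the uniform law on them and decode
   it by the union D of their sets T_x.  A second, independent draw hits D with
   mean at most M/C, so by a Chernoff bound two draws are confusable with
   probability at most e^(-M); a draw detects itself with probability about J.
   Hence about e^(M/2) draws can be chosen greedily with errors 1 - J and 0.

   Resolvability from information.  Outside T_x the law W_x is at most C W_p, so
   that the variance of the empirical output law of M draws is at most
   C W_p^2 / M; the parts inside T_x contribute at most 2 J to the distance.

   Identification against resolvability.  Two messages that are approximated by
   the same resolvability code cannot be separated by a decoding set, so the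
   number of messages is at most the number of resolvability codes. *)

Require Import Defs.
From HB Require Import structures.
From mathcomp Require Import all_boot all_order all_algebra.
From mathcomp Require Import all_classical all_reals all_analysis.
From mathcomp Require Import lra ring.
Import Order.TTheory GRing.Theory Num.Theory.
Local Open Scope classical_set_scope.
Local Open Scope ring_scope.

Arguments idN {R X Y} i : rename.
Arguments idQ {R X Y} i _ _ : rename.
Arguments idD {R X Y} i _ _ : rename.

(** * Upper and lower limits *)

Definition eventually (P : nat -> Prop) : Prop :=
  exists n0, forall n, (n0 <= n)%N -> P n.

Definition frequently (P : nat -> Prop) : Prop :=
  forall n0, exists2 n, (n0 <= n)%N & P n.

(* [Lim true] and [often true] are the limsup and its "for all large n";
   [Lim false] and [often false] the liminf and its "for infinitely many n".
   In both cases an upper bound on [Lim b u] is an [often b] upper bound on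
   [u], which lets the two chains of the theorem share one proof. *)
Definition Lim {R : realType} (b : bool) : (nat -> \bar R) -> \bar R :=
  if b then limn_esup else limn_einf.

Definition often (b : bool) (P : nat -> Prop) : Prop :=
  if b then eventually P else frequently P.

Lemma eventually_and (P Q : nat -> Prop) :
  eventually P -> eventually Q -> eventually (fun n => P n /\ Q n).
Proof.
move=> [n1 h1] [n2 h2]; exists (maxn n1 n2) => n; rewrite geq_max => /andP[l1 l2].
by split; [exact: h1 | exact: h2].
Qed.

Lemma often_and (b : bool) (P Q : nat -> Prop) :
  often b P -> eventually Q -> often b (fun n => P n /\ Q n).
Proof.
case: b => /= [|hP [n2 h2] n0]; first exact: eventually_and.
have [n] := hP (maxn n0 n2); rewrite geq_max => /andP[l1 l2] Pn.
by exists n => //; split => //; exact: h2.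
Qed.

Lemma often_all (b : bool) (P : nat -> Prop) : (forall n, P n) -> often b P.
Proof. by move=> h; case: b => [|n0]; [exists 0%N|exists n0]. Qed.

Lemma often_impl (b : bool) (P Q : nat -> Prop) :
  (forall n, P n -> Q n) -> often b P -> often b Q.
Proof.
move=> PQ; case: b => /= [[n0 h]|h n0]; first by exists n0 => n /h /PQ.
by have [n ? /PQ] := h n0; exists n.
Qed.

(** One of the two flags means all large [n], so the properties meet infinitely often. In the
    converse this plays a limsup condition on one side against a liminf condition on the other. *)
Lemma often_dual (b : bool) (P Q : nat -> Prop) :
  often b P -> often (~~ b) Q -> frequently (fun n => P n /\ Q n).
Proof.
case: b => /= hP hQ; last exact: (@often_and false).
by have := @often_and false _ _ hQ hP; apply: (@often_impl false) => n [].
Qed.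

Lemma often_frequently (b : bool) (P : nat -> Prop) : often b P -> frequently P.
Proof. by case: b => // -[n1 h] n0; exists (maxn n1 n0); [exact: leq_maxr|exact/h/leq_maxl]. Qed.

Section ExtendedLimits.
Variable R : realType.
Implicit Types (u v : nat -> \bar R) (l : \bar R).

Lemma limn_esup_le u l : eventually (fun n => (u n <= l)%E) -> (limn_esup u <= l)%E.
Proof.
move=> [n0 h]; apply: ge_ereal_inf; exists (ereal_sup [set u x | x in [set n | (n0 <= n)%N]]).
  by exists [set n | (n0 <= n)%N] => //; exists n0.
by apply: ge_ereal_sup => _ [n /= nn0 <-]; exact: h.
Qed.

Lemma limn_einf_ge u l : eventually (fun n => (l <= u n)%E) -> (l <= limn_einf u)%E.
Proof.
move=> [n0 h]; rewrite /limn_einf leeNr; apply: limn_esup_le; exists n0 => n nn0.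
by rewrite leeN2; exact: h.
Qed.

Lemma limn_esup_lt u l : (limn_esup u < l)%E -> eventually (fun n => (u n < l)%E).
Proof.
move=> /ereal_inf_lt[_ [V [n0 _ hV] <-] hl]; exists n0 => n nn0.
by apply: le_lt_trans hl; apply: ereal_sup_ubound; exists n => //; exact: hV.
Qed.

Lemma limn_einf_gt u l : (l < limn_einf u)%E -> eventually (fun n => (l < u n)%E).
Proof.
rewrite /limn_einf lteNr => /limn_esup_lt[n0 h]; exists n0 => n /h.
by rewrite lteN2.
Qed.

Lemma not_eventually (P : nat -> Prop) :
  ~ eventually P -> frequently (fun n => ~ P n).
Proof.
move=> h n0; apply: contrapT => h'; apply: h; exists n0 => n nn0.
by apply: contrapT => nP; apply: h'; exists n.
Qed.

Lemma lte_fin_dense (l : \bar R) (c : R) :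
  (l < c%:E)%E -> exists2 c' : R, (l < c'%:E)%E & c' < c.
Proof.
case: l => [r||] //=; rewrite ?lte_fin => h; first by exists ((r + c) / 2); rewrite ?lte_fin; lra.
by exists (c - 1); rewrite ?ltNyr//; lra.
Qed.

Lemma gte_fin_dense (l : \bar R) (c : R) :
  (c%:E < l)%E -> exists2 c' : R, (c'%:E < l)%E & c < c'.
Proof.
case: l => [r||] //=; rewrite ?lte_fin => h; first by exists ((r + c) / 2); rewrite ?lte_fin; lra.
by exists (c + 1); rewrite ?ltry//; lra.
Qed.

(** The intermediate [c'] keeps a uniform gap below [c], to which later error terms are charged. For
    the liminf this is the contrapositive of an eventual lower bound. *)
Lemma Lim_lt b u (c : R) : (Lim b u < c%:E)%E ->
  exists2 c' : R, c' < c & often b (fun n => (u n <= c'%:E)%E).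
Proof.
move=> /lte_fin_dense[c' h c'c]; exists c' => //; case: b h => /= h.
  by have [n0 h0] := limn_esup_lt _ _ h; exists n0 => n /h0 /ltW.
apply: (@often_impl false (fun n => ~ (c'%:E <= u n)%E)) => [n /negP|].
  by rewrite -ltNge => /ltW.
apply: not_eventually => /limn_einf_ge; rewrite leNgt => /negP; exact.
Qed.

(** The flag flips because a lower bound on a liminf holds for all large [n], one on a limsup only
    infinitely often. *)
Lemma Lim_gt b u (c : R) : (c%:E < Lim (~~ b) u)%E ->
  exists2 c' : R, c < c' & often b (fun n => (c'%:E <= u n)%E).
Proof.
move=> /gte_fin_dense[c' h c'c]; exists c' => //; case: b h => /= h.
  by have [n0 h0] := limn_einf_gt _ _ h; exists n0 => n /h0 /ltW.
apply: (@often_impl false (fun n => ~ (u n <= c'%:E)%E)) => [n /negP|].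
  by rewrite -ltNge => /ltW.
apply: not_eventually => /limn_esup_le; rewrite leNgt => /negP; exact.
Qed.

Lemma Lim_le b u l : often b (fun n => (u n <= l)%E) -> (Lim b u <= l)%E.
Proof.
case: b => /= [|h]; first exact: limn_esup_le.
rewrite leNgt; apply/negP => /limn_einf_gt h'.
have [n _ [h1 h2]] := @often_and false _ _ h h' 0%N.
by move: h2; rewrite ltNge h1.
Qed.

Lemma Lim_ge0 b u : (forall n, (0 <= u n)%E) -> (0 <= Lim b u)%E.
Proof.
move=> h; have h' : (0 <= limn_einf u)%E by apply: limn_einf_ge; exists 0%N.
by case: b => //=; apply: le_trans h' _; exact: limn_einf_sup.
Qed.

Lemma lee_add_pos (x : \bar R) (c : R) :
  (forall e : R, 0 < e -> (x <= (c + e)%:E)%E) -> (x <= c%:E)%E.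
Proof. by move=> h; apply/lee_addgt0Pr => e e0; rewrite -EFinD; exact: h. Qed.

End ExtendedLimits.

Lemma eventually_natr_ge (R : realType) (K : R) : eventually (fun n => K <= n%:R).
Proof.
exists (Num.trunc `|K|).+1 => n h; apply: (le_trans (ler_norm K)); apply: ltW.
by apply: (lt_le_trans (truncnS_gt _)); rewrite ler_nat.
Qed.

(** * Probabilities on countable sets *)

Lemma esumZl (R : realType) (T : choiceType) (I : set T) (c : R) (a : T -> \bar R) :
  0 <= c -> (forall i, (0 <= a i)%E) ->
  (\esum_(i in I) (c%:E * a i) = c%:E * \esum_(i in I) a i)%E.
Proof.
move=> c0 a0; rewrite /esum -ereal_supZl//; last first.
  by apply/set0P; eexists; exists set0 => //; exact: fsets_set0.
by congr ereal_sup; rewrite image_comp; apply: eq_imagel => A _ /=; rewrite ge0_mule_fsumr.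
Qed.

Lemma exists_le_of_sum_le (R : realType) (X : finType) (p f g : X -> R) :
  is_fdist p -> \sum_x p x * f x <= \sum_x p x * g x ->
  exists2 x, 0 < p x & f x <= g x.
Proof.
move=> [p0 p1] le_fg; apply: contrapT => no.
have lt_gf x : 0 < p x -> g x < f x.
  by move=> px; rewrite ltNge; apply/negP => fg; apply: no; exists x.
have [x px] : exists x, 0 < p x.
  apply: contrapT => npos; have : \sum_x p x = 0.
    apply: big1 => x _; apply/eqP; rewrite eq_le p0 andbT leNgt.
    by apply/negP => px; apply: npos; exists x.
  by rewrite p1 => /eqP; rewrite oner_eq0.
have : \sum_x p x * g x < \sum_x p x * f x.
  rewrite (bigD1 x)//= [ltRHS](bigD1 x)//= ltr_leD// ?ltr_pM2l ?lt_gf//.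
  apply: ler_sum => i _; have := p0 i; rewrite le_eqVlt => /orP[/eqP <-|pi].
    by rewrite !mul0r.
  by rewrite ler_pM2l// ltW ?lt_gf.
by rewrite ltNge le_fg.
Qed.

Lemma sum_fdist_const (R : realType) (X : finType) (p : X -> R) (c : R) :
  is_fdist p -> \sum_x p x * c = c.
Proof. by move=> [_ p1]; rewrite -mulr_suml p1 mul1r. Qed.

Definition pr {R : realType} {Y : countType} (q : Y -> R) (A : set Y) : R := fine (prob q A).

Section Distributions.
Variables (R : realType) (Y : countType) (q : Y -> R).
Hypothesis q_dist : is_dist q.

Let q0 y : (0 <= (q y)%:E)%E. Proof. by rewrite lee_fin; case: q_dist. Qed.

Lemma prob_split A : (prob q A + prob q (~` A) = 1)%E.
Proof.
by case: q_dist => _ <-; rewrite (esumID A) ?setTI// => y _; exact: q0.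
Qed.

Lemma prob_fin A : prob q A = (pr q A)%:E.
Proof.
rewrite /pr fineK// ge0_fin_numE; last exact: esum_ge0.
apply: (@le_lt_trans _ _ 1%E); last exact: ltry.
by rewrite -(prob_split A) leeDl//; exact: esum_ge0.
Qed.

Lemma pr_ge0 A : 0 <= pr q A.
Proof. by rewrite -lee_fin -prob_fin; exact: esum_ge0. Qed.

Lemma prC A : pr q (~` A) = 1 - pr q A.
Proof.
by have := prob_split A; rewrite !prob_fin -EFinD => -[<-]; lra.
Qed.

Lemma pr_le1 A : pr q A <= 1.
Proof. by have := pr_ge0 (~` A); rewrite prC; lra. Qed.

Lemma pr_mono A B : A `<=` B -> pr q A <= pr q B.
Proof.
move=> AB; rewrite -lee_fin -!prob_fin /prob esum_mkcond [leRHS]esum_mkcond.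
apply: le_esum => y _; case: ifPn => [/set_mem /AB Ay|_]; first by rewrite mem_set.
by case: ifP.
Qed.

Lemma pr_bigcup (I : eqType) (u : seq I) (T : I -> set Y) :
  pr q [set y | exists2 x, x \in u & T x y] <= \sum_(x <- u) pr q (T x).
Proof.
rewrite -lee_fin -prob_fin -sumEFin.
under [leRHS]eq_bigr do rewrite -prob_fin.
elim: u => [|x u IH].
  rewrite big_nil /prob esum1// => y [x]; by rewrite in_nil.
rewrite big_cons; apply: le_trans (leeD2l _ IH).
set U := [set y | exists2 z, z \in x :: u & T z y].
set V := [set y | exists2 z, z \in u & T z y].
rewrite /prob (esum_mkcond U) (esum_mkcond V) (esum_mkcond (T x)).
rewrite -esumD; [|by move=> y _; case: ifP..].
apply: le_esum => y _; case: ifPn => [/set_mem [z]|_]; last by rewrite adde_ge0//; case: ifP.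
rewrite inE => /orP[/eqP ->|zu] Ty.
  by rewrite (mem_set Ty) leeDl//; case: ifP.
have -> : y \in V by apply/mem_set; exists z.
by rewrite leeDr//; case: ifP.
Qed.

End Distributions.

Section Channel.
Variables (R : realType) (X : finType) (Y : countType) (W : X -> Y -> R).
Hypothesis W_ch : is_channel W.

Lemma channel_ge0 x y : 0 <= W x y. Proof. by case: (W_ch x). Qed.

Lemma outdist_ge0 (p : X -> R) y : (forall x, 0 <= p x) -> 0 <= outdist W p y.
Proof. by move=> p0; apply: sumr_ge0 => x _; rewrite mulr_ge0// channel_ge0. Qed.

Lemma esum_mix (p : X -> R) (f : X -> Y -> R) A :
  (forall x, 0 <= p x) -> (forall x y, 0 <= f x y) ->
  (\esum_(y in A) (\sum_x p x * f x y)%:E = \sum_x (p x)%:E * \esum_(y in A) (f x y)%:E)%E.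
Proof.
move=> p0 f0; under eq_esum do rewrite -sumEFin.
rewrite esum_sum; last by move=> y x _ _; rewrite lee_fin mulr_ge0.
apply: eq_bigr => x _; rewrite -esumZl// => y; by rewrite lee_fin.
Qed.

Lemma prob_outdist (p : X -> R) A : (forall x, 0 <= p x) ->
  prob (outdist W p) A = (\sum_x p x * pr (W x) A)%:E.
Proof.
move=> p0; rewrite /prob /outdist esum_mix//; last exact: channel_ge0.
rewrite -sumEFin; apply: eq_bigr => x _.
by rewrite -/(prob (W x) A) prob_fin.
Qed.

Lemma pr_outdist (p : X -> R) A : (forall x, 0 <= p x) ->
  pr (outdist W p) A = \sum_x p x * pr (W x) A.
Proof. by move=> p0; rewrite /pr prob_outdist. Qed.

Lemma outdist_dist (p : X -> R) : is_fdist p -> is_dist (outdist W p).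
Proof.
move=> [p0 p1]; split=> [y|]; first exact: outdist_ge0.
rewrite esum_mix//; last exact: channel_ge0.
under eq_bigr => x _. by case: (W_ch x) => _ ->; rewrite mule1; over.
by rewrite sumEFin p1.
Qed.

End Channel.

(** * Information spectrum *)

Definition infoset {R : realType} {X : finType} {Y : countType} (W : X -> Y -> R)
    (p : X -> R) (n : nat) (a : R) (x : X) : set Y :=
  [set y | a < n%:R^-1 * ln (W x y / outdist W p y)].

Definition tail {R : realType} {X : finType} {Y : countType} (W : X -> Y -> R)
    (p : X -> R) (n : nat) (a : R) : R :=
  \sum_x p x * pr (W x) (infoset W p n a x).

Section InformationSpectrum.
Variables (R : realType) (X : finType) (Y : countType) (W : X -> Y -> R).
Variables (p : X -> R) (n : nat).
Hypotheses (W_ch : is_channel W) (p_dist : is_fdist p) (n_gt0 : (0 < n)%N).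

Lemma info_tailE a : info_tail W p n a = (tail W p n a)%:E.
Proof.
rewrite /info_tail -sumEFin; apply: eq_bigr => x _.
by rewrite prob_fin.
Qed.

Lemma tail_le1 a : tail W p n a <= 1.
Proof.
rewrite -(@sum_fdist_const _ _ _ 1 p_dist); apply: ler_sum => x _.
by rewrite ler_wpM2l ?pr_le1//; case: p_dist.
Qed.

Lemma outdist_gt0 x y : 0 < p x -> 0 < W x y -> 0 < outdist W p y.
Proof.
move=> px Wxy; rewrite /outdist (bigD1 x)//=.
rewrite ltr_pwDl ?mulr_gt0// sumr_ge0// => i _.
by rewrite mulr_ge0 ?channel_ge0//; case: p_dist.
Qed.

Lemma infoset_lt a x y : 0 <= a -> infoset W p n a x y ->
  expR (n%:R * a) * outdist W p y <= W x y.
Proof.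
have n0 : 0 < n%:R :> R by rewrite ltr0n.
rewrite /infoset /= mulrC ltr_pdivlMr// => a0 h.
(* [ln] is 0 at nonpositive reals and division by 0 gives 0; since [0 <= a], the logarithm is
   strictly positive, which excludes both defaults. *)
have lpos : 0 < ln (W x y / outdist W p y).
  by apply: le_lt_trans h; rewrite mulr_ge0// ltW.
have rpos : 0 < W x y / outdist W p y.
  by rewrite ltNge; apply/negP => /ln0 l0; move: lpos; rewrite l0 ltxx.
have qpos : 0 < outdist W p y.
  rewrite lt_neqAle outdist_ge0 ?andbT; [|by []|by case: p_dist].
  by apply/eqP => q0; move: rpos; rewrite -q0 invr0 mulr0 ltxx.
by rewrite -ler_pdivlMr// -[leRHS]lnK ?posrE// ler_expR mulrC ltW.
Qed.

(** As [p x] is positive, [outdist W p y] is positive wherever [W x y] is, so the quotient is then a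
    genuine likelihood ratio. *)
Lemma infosetC_le a x y : 0 < p x -> ~ infoset W p n a x y ->
  W x y <= expR (n%:R * a) * outdist W p y.
Proof.
have n0 : 0 < n%:R :> R by rewrite ltr0n.
move=> px /negP; rewrite -leNgt mulrC ler_pdivrMr// => h.
have [->|Wn0] := eqVneq (W x y) 0.
  by rewrite mulr_ge0 ?expR_ge0// outdist_ge0//; case: p_dist.
have Wpos : 0 < W x y by rewrite lt_neqAle eq_sym Wn0 channel_ge0.
have qpos := outdist_gt0 _ _ px Wpos.
rewrite -ler_pdivrMr// -[leLHS]lnK ?posrE ?divr_gt0//.
by rewrite ler_expR [leRHS]mulrC.
Qed.

Lemma pr_outdist_infoset a x : 0 <= a ->
  pr (outdist W p) (infoset W p n a x) <= (expR (n%:R * a))^-1.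
Proof.
move=> a0; have qd := outdist_dist _ _ _ _ W_ch _ p_dist.
rewrite -[leRHS]mulr1 ler_pdivlMl ?expR_gt0//.
apply: (le_trans _ (pr_le1 _ _ _ (W_ch x) (infoset W p n a x))).
rewrite -lee_fin EFinM -!prob_fin// /prob -esumZl ?expR_ge0//; last first.
  by move=> y; rewrite lee_fin; case: qd.
by apply: le_esum => y h; rewrite -EFinM lee_fin; exact: infoset_lt.
Qed.

(** Outside the information set [W x] is at most [expR (n%:R * a)] times the output law, which
    bounds the missed mass. For negative [a] the tail is thus driven to 1. *)
Lemma tail_ge a : 1 - expR (n%:R * a) <= tail W p n a.
Proof.
have qd := outdist_dist _ _ _ _ W_ch _ p_dist; case: (p_dist) => p0 p1.
suff : \sum_x p x * pr (W x) (~` infoset W p n a x) <= expR (n%:R * a).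
  under eq_bigr do rewrite prC// mulrBr mulr1.
  by rewrite sumrB p1 -/(tail W p n a); lra.
rewrite -[leRHS](@sum_fdist_const _ _ _ _ p_dist); apply: ler_sum => x _.
have := p0 x; rewrite le_eqVlt => /orP[/eqP <-|px]; first by rewrite !mul0r.
rewrite ler_pM2l// -[leRHS]mulr1.
apply: (@le_trans _ _ (expR (n%:R * a) * pr (outdist W p) (~` infoset W p n a x))).
  rewrite -lee_fin EFinM -!prob_fin// /prob -esumZl ?expR_ge0//; last first.
    by move=> y; rewrite lee_fin; case: qd.
  by apply: le_esum => y h; rewrite -EFinM lee_fin; exact: infosetC_le.
by rewrite ler_wpM2l ?expR_ge0// pr_le1.
Qed.

End InformationSpectrum.

(** * Random sequences of inputs *)

(* Expectation of [f (x_1, ..., x_M)] for independent [x_i] of law [p]. *)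
Fixpoint Eseq {R : realType} {X : finType} (p : X -> R) (M : nat) (f : seq X -> R) : R :=
  if M is M'.+1 then \sum_x p x * Eseq p M' (fun s => f (x :: s)) else f [::].

Section Expectation.
Variables (R : realType) (X : finType) (p : X -> R).
Hypothesis p_dist : is_fdist p.
Implicit Types (f g : seq X -> R) (h : X -> R) (M : nat).

Let p0 x : 0 <= p x. Proof. by case: p_dist. Qed.

Lemma Eseq_le M f g :
  (forall s, size s = M -> f s <= g s) -> Eseq p M f <= Eseq p M g.
Proof.
elim: M f g => [|M IH] f g fg /=; first exact: fg.
by apply: ler_sum => x _; rewrite ler_wpM2l//; apply: IH => s sM; rewrite fg//= sM.
Qed.

Lemma eq_Eseq M f g :
  (forall s, size s = M -> f s = g s) -> Eseq p M f = Eseq p M g.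
Proof. by move=> fg; apply/eqP; rewrite eq_le !Eseq_le// => s /fg ->. Qed.

Lemma Eseq_cst M (c : R) : Eseq p M (fun=> c) = c.
Proof.
elim: M => //= M IH; under eq_bigr do rewrite IH.
exact: sum_fdist_const.
Qed.

Lemma EseqZ M (c : R) f : Eseq p M (fun s => c * f s) = c * Eseq p M f.
Proof.
elim: M f => //= M IH f; rewrite mulr_sumr; apply: eq_bigr => x _.
by rewrite IH mulrCA.
Qed.

Lemma EseqD M f g : Eseq p M (fun s => f s + g s) = Eseq p M f + Eseq p M g.
Proof.
elim: M f g => //= M IH f g; rewrite -big_split; apply: eq_bigr => x _ /=.
by rewrite IH mulrDr.
Qed.

Lemma EseqB M f g : Eseq p M (fun s => f s - g s) = Eseq p M f - Eseq p M g.
Proof.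
rewrite -[in RHS]mulN1r -EseqZ -EseqD.
by apply: eq_Eseq => s _; rewrite mulN1r.
Qed.

Lemma Eseq_big M (I : Type) (r : seq I) (F : I -> seq X -> R) :
  Eseq p M (fun s => \sum_(i <- r) F i s) = \sum_(i <- r) Eseq p M (F i).
Proof.
elim: r => [|i r IH].
  by rewrite big_nil -[RHS](Eseq_cst M); apply: eq_Eseq => s _; rewrite big_nil.
by rewrite big_cons -IH -EseqD; apply: eq_Eseq => s _; rewrite big_cons.
Qed.

Lemma Eseq_swap M N (F : seq X -> seq X -> R) :
  Eseq p M (fun s => Eseq p N (F s)) = Eseq p N (fun t => Eseq p M (F^~ t)).
Proof.
elim: M F => //= M IH F; rewrite Eseq_big; apply: eq_bigr => x _.
by rewrite EseqZ IH.
Qed.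

Lemma Eseq_prod M h :
  Eseq p M (fun s => \prod_(x <- s) h x) = (\sum_x p x * h x) ^+ M.
Proof.
elim: M => [|M IH] /=; first by rewrite big_nil expr0.
rewrite exprS mulr_suml; apply: eq_bigr => x _.
rewrite -mulrA -IH; congr (_ * _); rewrite -EseqZ.
by apply: eq_Eseq => s _; rewrite big_cons.
Qed.

Lemma Eseq_sum M h :
  Eseq p M (fun s => \sum_(x <- s) h x) = M%:R * \sum_x p x * h x.
Proof.
elim: M => [|M IH] /=; first by rewrite big_nil mul0r.
have E x : Eseq p M (fun s => \sum_(z <- x :: s) h z) = h x + M%:R * \sum_x p x * h x.
  rewrite -IH -[X in X + _](Eseq_cst M) -EseqD.
  by apply: eq_Eseq => s _; rewrite big_cons.
under eq_bigr do rewrite E mulrDr.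
by rewrite big_split/= sum_fdist_const// -natr1 mulrDl mul1r addrC.
Qed.

(** Independence and centring kill the cross terms. *)
Lemma Eseq_sum_sqr M h : \sum_x p x * h x = 0 ->
  Eseq p M (fun s => (\sum_(x <- s) h x) ^+ 2) = M%:R * \sum_x p x * h x ^+ 2.
Proof.
move=> h0; elim: M => [|M IH] /=; first by rewrite big_nil expr0n mul0r.
have E x : Eseq p M (fun s => (\sum_(z <- x :: s) h z) ^+ 2) =
    h x ^+ 2 + M%:R * \sum_x p x * h x ^+ 2.
  transitivity (Eseq p M (fun s => (h x ^+ 2 + 2 * h x * \sum_(z <- s) h z)
                                   + (\sum_(z <- s) h z) ^+ 2)).
    by apply: eq_Eseq => s _; rewrite big_cons; ring.
  by rewrite !EseqD Eseq_cst EseqZ Eseq_sum h0 IH; ring.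
under eq_bigr do rewrite E mulrDr.
by rewrite big_split/= sum_fdist_const// -natr1 mulrDl mul1r addrC.
Qed.

Lemma Eseq_sqr_le M f : (Eseq p M f) ^+ 2 <= Eseq p M (fun s => f s ^+ 2).
Proof.
set m := Eseq p M f.
have : 0 <= Eseq p M (fun s => (f s - m) ^+ 2).
  by rewrite -(Eseq_cst M 0); apply: Eseq_le => s _; exact: sqr_ge0.
have -> : Eseq p M (fun s => (f s - m) ^+ 2) =
    Eseq p M (fun s => (f s ^+ 2 + (- 2 * m) * f s) + m ^+ 2).
  by apply: eq_Eseq => s _; ring.
by rewrite !EseqD Eseq_cst EseqZ -/m; lra.
Qed.

Lemma Eseq_gt0 M f : 0 < Eseq p M f -> exists2 s, size s = M & 0 < f s.
Proof.
move=> h; apply: contrapT => no; move: h; rewrite ltNge => /negP; apply.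
rewrite -[leRHS](Eseq_cst M); apply: Eseq_le => s sM; rewrite leNgt.
by apply/negP => fs; apply: no; exists s.
Qed.

(** The first absolute moment is at most the root of the second. The variance of one summand is at
    most the mean of [h ^+ 2], hence at most [C * q] times the mean of [h], hence at most
    [C * q ^+ 2]. *)
Lemma Eseq_mean_deviation M h (C q : R) : (0 < M)%N -> 0 <= C -> 0 <= q ->
  (forall x, 0 <= h x) -> (forall x, 0 < p x -> h x <= C * q) ->
  \sum_x p x * h x <= q ->
  Eseq p M (fun s => `| \sum_(x <- s) (h x - \sum_z p z * h z) |)
    <= M%:R * (Num.sqrt (C / M%:R) * q).
Proof.
move=> M0 C0 q0 h0 hC hq; set m := \sum_z p z * h z.
have M0' : 0 < M%:R :> R by rewrite ltr0n.
have E0 : \sum_x p x * (h x - m) = 0.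
  under eq_bigr do rewrite mulrBr.
  by rewrite sumrB sum_fdist_const// subrr.
rewrite -[leLHS]ger0_norm; last by rewrite -(Eseq_cst M 0); apply: Eseq_le.
rewrite -[leRHS]ger0_norm; last by rewrite !mulr_ge0 ?sqrtr_ge0// ltW.
rewrite -ler_sqr ?nnegrE// !real_normK ?num_real//.
apply: (le_trans (Eseq_sqr_le _ _)).
under (@eq_Eseq M) => s _ do rewrite real_normK ?num_real//.
rewrite Eseq_sum_sqr// !exprMn sqr_sqrtr ?divr_ge0// ?ler0n//.
have -> : M%:R ^+ 2 * (C / M%:R * q ^+ 2) = M%:R * (C * q ^+ 2) by field; rewrite gt_eqF.
rewrite ler_pM2l//.
apply: (@le_trans _ _ (\sum_x p x * (C * q * h x))).
  apply: (@le_trans _ _ (\sum_x p x * h x ^+ 2)).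
    have -> : \sum_x p x * (h x - m) ^+ 2 = \sum_x p x * h x ^+ 2 - m ^+ 2.
      transitivity (\sum_x (p x * h x ^+ 2 - (2 * m) * (p x * h x) + p x * m ^+ 2)).
        by apply: eq_bigr => x _; ring.
      by rewrite big_split sumrB/= -mulr_sumr -/m sum_fdist_const//; ring.
    by rewrite lerBlDr lerDl sqr_ge0.
  apply: ler_sum => x _; have := p0 x; rewrite le_eqVlt => /orP[/eqP <-|px].
    by rewrite !mul0r.
  by rewrite ler_pM2l// expr2 ler_wpM2r// hC.
under eq_bigr do rewrite mulrCA.
by rewrite -mulr_sumr -/m expr2 mulrA ler_wpM2l ?mulr_ge0.
Qed.

(** Derandomisation by conditional expectations: inputs are fixed one at a time, each keeping the
    sum over [Y] of the conditional mean below the sum of [b]. *)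
Lemma Eseq_esum_le (Y : countType) M (F : seq X -> Y -> R) (b : Y -> R) :
  (forall s y, 0 <= F s y) -> (forall y, Eseq p M (F^~ y) <= b y) ->
  (\esum_(y in [set: Y]) (b y)%:E < +oo)%E ->
  exists2 s, size s = M &
    (\esum_(y in [set: Y]) (F s y)%:E <= \esum_(y in [set: Y]) (b y)%:E)%E.
Proof.
elim: M F b => [|M IH] F b F0 /= Fb bfin.
  by exists [::] => //; apply: le_esum => y _; rewrite lee_fin.
pose bx x y := Eseq p M (fun s => F (x :: s) y).
have bx0 x y : 0 <= bx x y by rewrite -(Eseq_cst M 0); apply: Eseq_le.
pose S x := (\esum_(y in [set: Y]) (bx x y)%:E)%E.
have S0 x : (0 <= S x)%E by apply: esum_ge0 => y _; rewrite lee_fin.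
have b0 : (0 <= \esum_(y in [set: Y]) (b y)%:E)%E.
  apply: esum_ge0 => y _; rewrite lee_fin; apply: le_trans (Fb y).
  by apply: sumr_ge0 => x _; rewrite mulr_ge0//; exact: bx0.
have sumS : (\sum_x (p x)%:E * S x <= \esum_(y in [set: Y]) (b y)%:E)%E.
  by rewrite -esum_mix//; apply: le_esum => y _; rewrite lee_fin; exact: Fb.
have [x px Sx] : exists2 x, 0 < p x & (S x <= \esum_(y in [set: Y]) (b y)%:E)%E.
  (* [S x] can be infinite only where [p x = 0]; there [fine] is harmless because the weight is
     0. *)
  have Sfin x : 0 < p x -> S x \is a fin_num.
    move=> px; rewrite ge0_fin_numE//.
    have : ((p x)%:E * S x < +oo)%E.
      apply: le_lt_trans bfin; apply: le_trans sumS.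
      by rewrite (bigD1 x)//= leeDl// sume_ge0// => i _; rewrite mule_ge0// lee_fin.
    move=> h; rewrite ltey; apply/eqP => Sy; move: h.
    by rewrite Sy gt0_muley ?lte_fin// ltxx.
  have bE : \esum_(y in [set: Y]) (b y)%:E = (fine (\esum_(y in [set: Y]) (b y)%:E))%:E.
    by rewrite fineK// ge0_fin_numE.
  have [|x px h] := @exists_le_of_sum_le _ _ p (fun x => fine (S x))
      (fun=> fine (\esum_(y in [set: Y]) (b y)%:E)) p_dist.
    rewrite sum_fdist_const// -lee_fin -bE -sumEFin; apply: le_trans sumS.
    apply: lee_sum => x _; have := p0 x; rewrite le_eqVlt => /orP[/eqP <-|px].
      by rewrite mul0r mul0e.
    by rewrite EFinM fineK// Sfin.
  by exists x => //; rewrite bE -(fineK (Sfin x px)) lee_fin.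
have [s sM hs] := IH (fun s => F (x :: s)) (bx x) (fun s y => F0 _ _) (fun y => lexx _)
  (le_lt_trans Sx bfin).
by exists (x :: s); [rewrite /= sM|exact: le_trans hs Sx].
Qed.

End Expectation.

(** * Channel resolvability *)

Section Resolvability.
Variables (R : realType) (X : finType) (Y : countType) (W : X -> Y -> R).
Variables (p : X -> R) (n : nat) (a : R).
Hypotheses (W_ch : is_channel W) (p_dist : is_fdist p) (n_gt0 : (0 < n)%N).

Let p0 x : 0 <= p x. Proof. by case: p_dist. Qed.
Let C := expR (n%:R * a).
Let q := outdist W p.
Let inT x y : R := (y \in infoset W p n a x)%:R.

(* The part of [W_x] outside [infoset x] is bounded by [C q], so that its
   empirical mean has small variance; the part inside has total mass [tail]
   and is estimated trivially, once for the mean and once for its limit. *)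
Lemma Eseq_res_err_pointwise M y : (0 < M)%N ->
  Eseq p M (fun s => `| M%:R^-1 * \sum_(x <- s) W x y - q y |)
    <= Num.sqrt (C / M%:R) * q y + 2 * \sum_x p x * (W x y * inT x y).
Proof.
move=> M0; have M0' : 0 < M%:R :> R by rewrite ltr0n.
have inT01 x : 0 <= inT x y <= 1 by rewrite /inT; case: (_ \in _); rewrite ?lexx ?ler01.
pose A x := W x y * inT x y; pose B x := W x y * (1 - inT x y).
have A0 x : 0 <= A x by case/andP: (inT01 x) => ? _; rewrite mulr_ge0// channel_ge0.
have B0 x : 0 <= B x.
  by case/andP: (inT01 x) => _ ?; rewrite mulr_ge0 ?channel_ge0// subr_ge0.
pose alpha := \sum_x p x * A x; pose beta := \sum_x p x * B x.
have qE : q y = alpha + beta.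
  by rewrite -big_split; apply: eq_bigr => x _ /=; rewrite /A /B; ring.
have alpha0 : 0 <= alpha by apply: sumr_ge0 => x _; rewrite mulr_ge0.
have q0 : 0 <= q y by exact: outdist_ge0.
have C0 : 0 <= C by exact: expR_ge0.
apply: (@le_trans _ _ (Eseq p M (fun s =>
   M%:R^-1 * `| \sum_(x <- s) (B x - beta) | + M%:R^-1 * \sum_(x <- s) A x + alpha))).
  apply: Eseq_le => // s sM.
  have -> : M%:R^-1 * \sum_(x <- s) W x y - q y =
     M%:R^-1 * (\sum_(x <- s) (B x - beta)) + M%:R^-1 * \sum_(x <- s) A x - alpha.
    rewrite sumrB big_const_seq count_predT sM iter_addr_0 -[beta *+ M]mulr_natl qE.
    have -> : \sum_(x <- s) W x y = \sum_(x <- s) A x + \sum_(x <- s) B x.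
      by rewrite -big_split; apply: eq_bigr => x _ /=; rewrite /A /B; ring.
    by field; rewrite gt_eqF.
  apply: (le_trans (ler_normB _ _)); rewrite (ger0_norm alpha0) lerD2r.
  apply: (le_trans (ler_normD _ _)); rewrite !normrM ger0_norm ?invr_ge0 ?ler0n//.
  by rewrite lerD2l ger0_norm// sumr_ge0.
rewrite !EseqD !EseqZ// Eseq_cst// Eseq_sum// -/alpha mulrA mulVf ?gt_eqF// mul1r.
have : Eseq p M (fun s => `|\sum_(x <- s) (B x - beta)|) <=
    M%:R * (Num.sqrt (C / M%:R) * q y).
  apply: Eseq_mean_deviation => //; last by rewrite -/beta qE lerDr.
  move=> x px; rewrite /B /inT; case: (boolP (y \in _)) => [_|yT].
    by rewrite subrr mulr0 mulr_ge0.
  by rewrite subr0 mulr1; apply: infosetC_le => //; rewrite notin_setE in yT.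
rewrite -ler_pdivrMl// => h; lra.
Qed.

Lemma esum_infoset : (\esum_(y in [set: Y]) (\sum_x p x * (W x y * inT x y))%:E =
  (tail W p n a)%:E)%E.
Proof.
have WT0 x y : 0 <= W x y * inT x y by apply: mulr_ge0; [exact: channel_ge0|exact: ler0n].
rewrite esum_mix//.
rewrite -sumEFin; apply: eq_bigr => x _; rewrite EFinM; congr (_ * _)%E.
rewrite -prob_fin// /prob [RHS]esum_mkcond; apply: eq_esum => y _.
by rewrite /inT; case: ifP; rewrite ?mulr1 ?mulr0.
Qed.

(** The pointwise bound is summed over [y], where the output law contributes 1 and the parts inside
    the information sets contribute the tail; then a sequence at least as good as the mean is
    picked. *)
Lemma exists_resolvability_code M : (0 < M)%N ->
  exists2 s, size s = M &
    (res_err W s (outdist W p) <=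
      (Num.sqrt (expR (n%:R * a) / M%:R) + 2 * tail W p n a)%:E)%E.
Proof.
move=> M0; have [q0 q1] := outdist_dist _ _ _ _ W_ch _ p_dist.
pose b y := Num.sqrt (C / M%:R) * q y + 2 * \sum_x p x * (W x y * inT x y).
have in0 y : 0 <= \sum_x p x * (W x y * inT x y).
  by apply: sumr_ge0 => x _; apply: mulr_ge0 => //;
    apply: mulr_ge0; [exact: channel_ge0|exact: ler0n].
have bE : (\esum_(y in [set: Y]) (b y)%:E)%E =
    (Num.sqrt (C / M%:R) + 2 * tail W p n a)%:E.
  under eq_esum do rewrite EFinD !EFinM.
  rewrite esumD; last 2 first.
  - by move=> y _; rewrite -EFinM lee_fin mulr_ge0// ?sqrtr_ge0//; exact: q0.
  - by move=> y _; rewrite -EFinM lee_fin mulr_ge0.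
  have q0E y : (0 <= (q y)%:E)%E by rewrite lee_fin; exact: q0.
  have in0E y : (0 <= (\sum_x p x * (W x y * inT x y))%:E)%E by rewrite lee_fin.
  by rewrite !esumZl ?sqrtr_ge0// q1 mule1 esum_infoset.
have [|||s sM hs] := @Eseq_esum_le _ _ _ p_dist Y M
   (fun s y => `| M%:R^-1 * \sum_(x <- s) W x y - q y |) b.
- by [].
- by move=> y; exact: Eseq_res_err_pointwise.
- by rewrite bE ltry.
by exists s => //; rewrite -bE /res_err sM.
Qed.

End Resolvability.

(** * Identification codes and resolvability *)

Section VariationalDistance.
Variables (R : realType) (Y : countType).
Implicit Types q : Y -> R.

Lemma prob_le_deviation q1 q2 A : (forall y, 0 <= q2 y) ->
  (prob q1 A <= prob q2 A + \esum_(y in A) `|q1 y - q2 y|%:E)%E.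
Proof.
move=> q20; rewrite /prob -esumD; [|by move=> y _; rewrite lee_fin..].
apply: le_esum => y _; rewrite -EFinD lee_fin.
by have := ler_norm (q1 y - q2 y); lra.
Qed.

(** The laws differ by the same amount on [A] and on its complement, and the distance counts both:
    hence the factor 2. *)
Lemma pr_sub_le_variation q1 q2 A : is_dist q1 -> is_dist q2 ->
  ((2 * (pr q1 A - pr q2 A))%:E <= \esum_(y in [set: Y]) `|q1 y - q2 y|%:E)%E.
Proof.
move=> d1 d2; rewrite (esumID A); last by move=> y _; rewrite lee_fin.
rewrite !setTI.
have h1 := prob_le_deviation q1 q2 A (proj1 d2).
have h2 := prob_le_deviation q2 q1 (~` A) (proj1 d1).
move: h1 h2; rewrite !prob_fin//.
rewrite (_ : \esum_(y in ~` A) `|q2 y - q1 y|%:E = \esum_(y in ~` A) `|q1 y - q2 y|%:E)%E;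
  last by apply: eq_esum => y _; rewrite distrC.
rewrite !prC//.
set u := (\esum_(y in A) _)%E; set v := (\esum_(y in ~` A) _)%E.
have u0 : (0 <= u)%E by apply: esum_ge0 => y _; rewrite lee_fin.
have v0 : (0 <= v)%E by apply: esum_ge0 => y _; rewrite lee_fin.
case: u u0 => [u||]//= _; last by rewrite addye ?leey//; case: v v0.
case: v v0 => [v||]//= _; last by rewrite addey ?leey.
by rewrite -!EFinD !lee_fin; lra.
Qed.

Lemma variation_triangle q1 q2 w :
  (\esum_(y in [set: Y]) `|q1 y - q2 y|%:E <=
   \esum_(y in [set: Y]) `|w y - q1 y|%:E + \esum_(y in [set: Y]) `|w y - q2 y|%:E)%E.
Proof.
rewrite -esumD; [|by move=> y _; rewrite lee_fin..].
apply: le_esum => y _; rewrite -EFinD lee_fin (distrC (w y) (q1 y)).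
exact: ler_distD.
Qed.

End VariationalDistance.

Section IdentificationConverse.
Variables (R : realType) (X : finType) (Y : countType) (W : X -> Y -> R).
Hypothesis W_ch : is_channel W.
Variable c : idcode R X Y.
Hypothesis c_code : is_idcode c.

Lemma id_mu_ge i : (prob (outdist W (idQ c i)) (~` idD c i) <= id_mu W c)%E.
Proof. exact: (le_bigmax _ (fun i => prob (outdist W (idQ c i)) (~` idD c i))). Qed.

Lemma id_lambda_ge i j : j != i ->
  (prob (outdist W (idQ c j)) (idD c i) <= id_lambda W c)%E.
Proof.
move=> ji; pose F i := \big[maxe/0%E]_(j < idN c | j != i) prob (outdist W (idQ c j)) (idD c i).
by apply: le_trans (le_bigmax _ F i); exact: (@le_bigmax_cond _ _ _ _ j).
Qed.

(* Messages [i <> j] approximated by the same resolvability code would have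
   output laws at distance less than [2 e], although [D_i] separates them. *)
Lemma idcode_size_le (m l e M : R) :
  (id_mu W c <= m%:E)%E -> (id_lambda W c <= l%:E)%E -> (eps_res W M < e%:E)%E ->
  e + m + l <= 1 -> 1 <= M /\ (idN c <= #|X|.+1 ^ Num.trunc M)%N.
Proof.
move=> hm hl he eml; case: c_code => N0 Qd.
have od i := outdist_dist _ _ _ _ W_ch _ (Qd i).
have /choice[s hs] : forall i, exists s : seq X,
    [/\ (0 < size s)%N, (size s)%:R <= M & (res_err W s (outdist W (idQ c i)) < e%:E)%E].
  move=> i; have : (ereal_inf [set res_err W s (outdist W (idQ c i)) |
      s in [set s : seq X | (0 < size s)%N /\ ((size s)%:R <= M)%R]] < e%:E)%E.
    by apply: le_lt_trans he; apply: ereal_sup_ubound; exists (idQ c i).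
  by move=> /ereal_inf_lt[_ [s [s0 sM] <-] hs]; exists s.
have M1 : 1 <= M.
  by have [s0 + _] := hs (Ordinal N0); apply: le_trans; rewrite ler1n.
(* Codes of length at most [M] are padded with [None] to a common length, so that
   [#|X|.+1 ^ Num.trunc M] bounds their number. *)
split=> //; pose f i : {ffun 'I_(Num.trunc M) -> option X} := [ffun k => onth (s i) (val k)].
have f_inj : injective f.
  move=> i j fij; have sij : s i = s j.
    have out k t : (Num.trunc M <= k)%N -> onth (s t) k = None.
      move=> Mk; apply: onth_default; apply: leq_trans Mk.
      by have [_ sM _] := hs t; rewrite truncn_ge_nat// (le_trans ler01).
    apply: eq_from_onth => k; case: (ltnP k (Num.trunc M)) => kM; last by rewrite !out.
    by have /ffunP/(_ (Ordinal kM)) := fij; rewrite !ffunE.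
  apply/eqP; apply: contrapT => /negP; rewrite eq_sym => nij.
  (* [idD c i] has probability at least [1 - m] under message [i] and at most [l] under [j], which
     forces a distance of at least [2 * (1 - m - l)], hence at least [2 * e]. *)
  have := pr_sub_le_variation _ _ _ _ (idD c i) (od i) (od j).
  apply/negP; rewrite -ltNge.
  apply: (le_lt_trans (variation_triangle _ _ _ _
    (fun y => (size (s i))%:R^-1 * \sum_(x <- s i) W x y))).
  have [_ _ hi] := hs i; have [_ _ hj] := hs j; rewrite -sij in hj.
  apply: (@lt_le_trans _ _ (e%:E + e%:E)%E); first exact: lteD hi hj.
  rewrite -EFinD lee_fin.
  have := le_trans (id_mu_ge i) hm; have := le_trans (id_lambda_ge _ _ nij) hl.
  by rewrite !prob_fin// prC// !lee_fin; lra.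
have := leq_card f f_inj; by rewrite card_ffun card_option !card_ord.
Qed.

End IdentificationConverse.

(** Here [ln N] is at most [expR (n%:R * r)] times a factor linear in [n], which [expR (n%:R * g)]
    absorbs. *)
Lemma idrate_le (R : realType) (d : nat) (r g : R) : (0 < d)%N -> 0 <= r -> 0 < g ->
  eventually (fun n => forall N, (0 < N)%N ->
    (N <= (d ^ n).+1 ^ Num.trunc (expR (n%:R * r)))%N ->
    (idrate R n N <= (r + g)%:E)%E).
Proof.
move=> d0 r0 g0; set K := ln (d.+1%:R : R).
have K0 : 0 <= K by rewrite ln_ge0// ler1n.
have [n1 h1] := eventually_natr_ge _ (1 + 2 * K / g ^+ 2); exists n1 => n /h1 nK N N0 hN.
have n0 : 1 <= n%:R :> R.
  apply: le_trans nK; rewrite lerDl divr_ge0 ?sqr_ge0// mulr_ge0//.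
have nn0 : (0 < n)%N by rewrite -(ltr_nat R) (lt_le_trans ltr01).
have nKexp : n%:R * K <= expR (n%:R * g).
  apply: (le_trans _ (expR_ge1Dxn 1 _)); last by rewrite mulr_ge0 ?ler0n// ltW.
  have g20 : 0 < g ^+ 2 by rewrite exprn_gt0.
  have : 2 * K <= n%:R * g ^+ 2.
    by rewrite -ler_pdivrMr//; apply: le_trans nK; rewrite lerDr.
  have -> : (2`!)%:R = 2 :> R by [].
  have n0' : 0 <= n%:R :> R by rewrite ler0n.
  move=> h; have := ler_wpM2l n0' h; rewrite exprMn; nra.
have lnN : ln (N%:R : R) <= expR (n%:R * (r + g)).
  apply: (@le_trans _ _ (ln (((d.+1 ^ n) ^ Num.trunc (expR (n%:R * r)))%N%:R : R))).
    rewrite ler_ln ?posrE ?ltr0n ?expn_gt0//= ler_nat.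
    apply: (leq_trans hN); rewrite leq_exp2r; last first.
      by rewrite truncn_gt0 -expR0 ler_expR mulr_ge0 ?ler0n.
    (* The bound of [(d ^ n).+1] by [d.+1 ^ n] fails at [n = 0], so the induction starts at 1. *)
    elim: n nn0 {h1 nK hN n0 nKexp} => // -[|n] IH _; first by rewrite !expn1.
    rewrite expnS (expnS d.+1); apply: (@leq_trans (d.+1 * (d ^ n.+1).+1)); last first.
      by rewrite leq_mul2l IH.
    by rewrite mulSn mulnS addSn ltnS -[leqLHS]add0n leq_add// leq_addl.
  rewrite -expnM natrX lnXn ?ltr0n// -/K -[K *+ _]mulr_natl natrM.
  rewrite mulrDr expRD mulrAC mulrC.
  apply: ler_pM => //; first by rewrite mulr_ge0 ?ler0n.
  by rewrite truncn_le expR_ge0.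
rewrite lee_fin ler_pdivrMl ?ltr0n//.
have [l0|l0] := leP (ln N%:R : R) 0.
  by rewrite ln0// mulr_ge0// ?ler0n// addr_ge0// ltW.
by rewrite -[leRHS]expRK ler_ln// posrE expR_gt0.
Qed.

(** * Construction of identification codes *)

Lemma expR_le_chord (R : realType) (s f : R) : 0 <= f <= 1 ->
  expR (s * f) <= 1 + f * (expR s - 1).
Proof.
(* Average of the tangent inequalities [e^u >= e^(s f) (1 + u - s f)] at [u = s] and [u = 0]. *)
move=> /andP[f0 f1]; have E := expR_gt0 (s * f).
have h1 : expR (s * f) * (1 + s - s * f) <= expR s.
  have -> : expR s = expR (s * f) * expR (s - s * f) by rewrite -expRD; congr expR; ring.
  by rewrite ler_pM2l// -addrA expR_ge1Dx.
have h2 : expR (s * f) * (1 - s * f) <= 1.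
  have e1 : expR (s * f) * expR (- (s * f)) = 1 by rewrite -expRD subrr expR0.
  by rewrite -[leRHS]e1 ler_pM2l// expR_ge1Dx.
have k1 := ler_wpM2l f0 h1.
have f1' : 0 <= 1 - f by rewrite subr_ge0.
have k2 := ler_wpM2l f1' h2.
lra.
Qed.

Lemma sum_count_mem (R : realType) (X : finType) (u : seq X) (g : X -> R) :
  \sum_x (count_mem x u)%:R * g x = \sum_(x <- u) g x.
Proof.
elim: u => [|z u IH]; first by rewrite big_nil big1// => x _; rewrite mul0r.
rewrite big_cons -IH (bigD1 z)//= [in RHS](bigD1 z)//= eqxx natrD mulrDl mul1r -addrA.
congr (_ + (_ + _)); apply: eq_bigr => x xz.
by rewrite eq_sym (negbTE xz) add0n.
Qed.

(** * Random codewords, their mutual confusion and their reliability *)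

Section RandomIdentificationCode.
Variables (R : realType) (X : finType) (Y : countType) (W : X -> Y -> R).
Variables (p : X -> R) (T : X -> set Y) (M : nat) (K s tau : R).
Hypotheses (W_ch : is_channel W) (p_dist : is_fdist p) (M_gt0 : (0 < M)%N).
Hypothesis T_small : forall x, pr (outdist W p) (T x) <= K.
Hypotheses (s_ge0 : 0 <= s) (K_small : M%:R * K * expR s <= 1).
Hypotheses (tau_le1 : 0 < tau <= 1) (s_tau : 2 <= s * tau).

Let p0 x : 0 <= p x. Proof. by case: p_dist. Qed.
Let M0 : 0 < M%:R :> R. Proof. by rewrite ltr0n. Qed.

Definition decoder (u : seq X) : set Y := [set y | exists2 x, x \in u & T x y].

(** For [v] of length [M], the probability of accepting message [u] when [v] is sent. *)
Definition crossing (u v : seq X) : R := M%:R^-1 * \sum_(x <- v) pr (W x) (decoder u).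

Definition confusable (u v : seq X) : bool := tau < crossing u v.

Definition confusability (v : seq X) : R := Eseq p M (fun u => (confusable u v)%:R).

Definition mean_hit : R := \sum_x p x * pr (W x) (T x).

Definition reliable (v : seq X) : bool :=
  mean_hit - tau <= M%:R^-1 * \sum_(x <- v) pr (W x) (T x).

Let r : R := expR (- M%:R / 2).

Lemma mean_hit_ge0 : 0 <= mean_hit.
Proof. by apply: sumr_ge0 => x _; rewrite mulr_ge0// pr_ge0. Qed.

Lemma mean_hit_le1 : mean_hit <= 1.
Proof.
rewrite -(@sum_fdist_const _ _ _ 1 p_dist); apply: ler_sum => x _.
by rewrite ler_wpM2l// pr_le1.
Qed.

(** Chernoff bound with parameter [s]: the union bound gives each summand mean at most [M%:R * K],
    so the exponential moment is at most [expR M%:R], against a factor at most [expR (- 2 * M%:R)]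
    from the threshold [tau]. *)
Lemma Eseq_confusable_le u : size u = M ->
  Eseq p M (fun v => (confusable u v)%:R) <= expR (- M%:R).
Proof.
move=> uM; pose f x := pr (W x) (decoder u).
have f01 x : 0 <= f x <= 1 by rewrite pr_ge0// pr_le1.
have mean_f : \sum_x p x * f x <= M%:R * K.
  rewrite -pr_outdist//.
  apply: (le_trans (pr_bigcup _ _ _ (outdist_dist _ _ _ _ W_ch _ p_dist) _ _ _)).
  apply: (@le_trans _ _ (\sum_(x <- u) K)); first by apply: ler_sum.
  by rewrite big_const_seq count_predT uM iter_addr_0 mulr_natl.
apply: (@le_trans _ _ (Eseq p M (fun v => expR (- (s * M%:R * tau)) *
    \prod_(x <- v) expR (s * f x)))).
  apply: Eseq_le => // v vM; rewrite -expR_sum -expRD -mulr_sumr.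
  rewrite /confusable /crossing ltr_pdivlMl//.
  case: (ltP _ (\sum_(x <- v) _)) => [h|_]; last exact: expR_ge0.
  rewrite -[leLHS]expR0 ler_expR -mulrA addrC -mulrBr mulr_ge0//.
  by rewrite subr_ge0 ltW.
rewrite EseqZ Eseq_prod//.
apply: (@le_trans _ _ (expR (- (s * M%:R * tau)) * expR M%:R)).
  rewrite ler_pM2l ?expR_gt0// -[M%:R in leRHS]mulr1 expRM_natl lerXn2r ?nnegrE ?expR_ge0//.
    by apply: sumr_ge0 => x _; rewrite mulr_ge0// expR_ge0.
  apply: (@le_trans _ _ (\sum_x p x * (1 + f x * expR s))).
    apply: ler_sum => x _; rewrite ler_wpM2l//.
    apply: (le_trans (expR_le_chord _ _ _ (f01 x))); rewrite lerD2l ler_wpM2l//.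
      by case/andP: (f01 x).
    by rewrite lerBlDr lerDl.
  under eq_bigr do rewrite mulrDr mulrA.
  rewrite big_split/= sum_fdist_const// -mulr_suml.
  apply: (le_trans _ (expR_ge1Dx _)); rewrite lerD2l.
  by apply: le_trans K_small; rewrite ler_wpM2r ?expR_ge0.
rewrite -expRD ler_expR.
have : M%:R * 2 <= M%:R * (s * tau) by rewrite ler_pM2l.
lra.
Qed.

Lemma exp_le_r : expR (- M%:R) <= r.
Proof. by rewrite ler_expR; have := M0; lra. Qed.

(** The Chernoff bound fixes [u] and draws [v]; exchanging expectations and applying Markov controls
    the other direction. As [r] is the square root of that bound, it serves both as threshold and as
    exceptional probability. *)
Lemma Eseq_confusability_gt : Eseq p M (fun v => (r < confusability v)%R%:R) <= r.
Proof.
have r0 : 0 < r by exact: expR_gt0.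
have c0 v : 0 <= confusability v.
  by rewrite -(@Eseq_cst _ _ _ p_dist M 0); apply: Eseq_le => // u _; exact: ler0n.
apply: (@le_trans _ _ (Eseq p M (fun v => r^-1 * confusability v))).
  apply: Eseq_le => // v _; case: ltP => h; last by rewrite mulr_ge0// invr_ge0 ltW.
  by rewrite ler_pdivlMl// mulr1 ltW.
rewrite EseqZ ler_pdivrMl// /confusability Eseq_swap//.
apply: (@le_trans _ _ (expR (- M%:R))).
  rewrite -[leRHS](@Eseq_cst _ _ _ p_dist M); apply: Eseq_le => // u uM.
  exact: Eseq_confusable_le.
by rewrite -expRD ler_expR; lra.
Qed.

(** Reverse Markov inequality: the excess over [mean_hit - tau] has mean [tau], is negative on
    unreliable [v] and never exceeds [1 + tau <= 2]. *)
Lemma Eseq_reliable : tau / 2 <= Eseq p M (fun v => (reliable v)%:R).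
Proof.
have /andP[t0 t1] := tau_le1.
have : Eseq p M (fun v => M%:R^-1 * \sum_(x <- v) pr (W x) (T x) - (mean_hit - tau))
    <= Eseq p M (fun v => 2 * (reliable v)%:R).
  apply: Eseq_le => // v vM; rewrite /reliable; case: (leP (mean_hit - tau)) => h; last first.
    by rewrite mulr0 subr_le0 ltW.
  have : M%:R^-1 * \sum_(x <- v) pr (W x) (T x) <= 1.
    rewrite ler_pdivrMl// mulr1 -[in leRHS]vM -sum1_size natr_sum.
    by apply: ler_sum => x _; exact: pr_le1.
  by have := mean_hit_ge0; rewrite mulr1; lra.
rewrite EseqB// !EseqZ Eseq_cst// Eseq_sum// -/mean_hit mulKf ?gt_eqF//; lra.
Qed.

(* Each codeword kept so far rules out a set of sequences of probability at
   most [2 r], so that a new one is available as long as [(2 k + 1) r < tau / 2]. *)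
Lemma exists_codewords k : (2 * k%:R + 1) * r < tau / 2 ->
  exists L : seq (seq X), [/\ size L = k,
    forall v, v \in L -> [/\ size v = M, reliable v & confusability v <= r] &
    pairwise (fun u v => ~~ confusable u v && ~~ confusable v u) L].
Proof.
have r0 : 0 < r by exact: expR_gt0.
elim: k => [_|k IH hk]; first by exists [::].
have [|L [Lk hL pL]] := IH.
  by apply: le_lt_trans hk; rewrite ler_pM2r// lerD2r ler_pM2l// ler_nat.
pose g v : nat := (reliable v); pose h v : nat := (r < confusability v)%R.
pose S v := (\sum_(u <- L) (confusable u v + confusable v u))%N.
have [|v vM pos] := @Eseq_gt0 _ _ _ p_dist M (fun v => (g v)%:R - (h v)%:R - (S v)%:R).
  rewrite !EseqB//.
  have hS : Eseq p M (fun v => (S v)%:R) <= k%:R * (2 * r).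
    under (@eq_Eseq _ _ _ p_dist M) => v _ do rewrite natr_sum.
    rewrite Eseq_big// -Lk -sum1_size natr_sum mulr_suml !big_seq.
    apply: ler_sum => u /hL[uM _ cu]; rewrite mul1r.
    under (@eq_Eseq _ _ _ p_dist M) => v _ do rewrite natrD.
    rewrite EseqD mulr2n mulrDl mul1r lerD//.
    exact: le_trans (Eseq_confusable_le _ uM) exp_le_r.
  have hg : tau / 2 <= Eseq p M (fun v => (g v)%:R) := Eseq_reliable.
  have hh : Eseq p M (fun v => (h v)%:R) <= r := Eseq_confusability_gt.
  by move: hk; rewrite -(natr1 k); lra.
(* All three are natural numbers and [g v] is at most 1, so [v] is reliable and both penalties
   vanish. *)
have : (h v + S v < g v)%N.
  by rewrite -(ltr_nat R) natrD; lra.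
rewrite /g /h; case gv : (reliable v) => //=; rewrite ltnS leqn0 addn_eq0 eqb0 -leNgt.
move=> /andP[hv]; rewrite sum_nat_seq_eq0 => /allP Sv.
exists (v :: L); split=> [|w|]; first by rewrite /= Lk.
  by rewrite inE => /orP[/eqP ->|/hL].
rewrite /= pL andbT; apply/allP => u /Sv /=.
by rewrite addn_eq0 !eqb0 => /andP[-> ->].
Qed.

Lemma exists_idcode N : (0 < N)%N ->
  (2 * N%:R + 1) * expR (- M%:R / 2) < tau / 2 ->
  exists c : idcode R X Y, [/\ is_idcode c, idN c = N,
    (id_mu W c <= (1 - mean_hit + tau)%:E)%E & (id_lambda W c <= tau%:E)%E].
Proof.
have /andP[t0 t1] := tau_le1.
move=> N0 /exists_codewords[L [LN hL pL]].
pose u (i : 'I_N) := nth [::] L i.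
have uL i : u i \in L by apply: mem_nth; rewrite LN.
have uM i : size (u i) = M by have [] := hL _ (uL i).
(* The uniform law on the codeword, repeated inputs being counted with multiplicity. *)
pose Q i x : R := M%:R^-1 * (count_mem x (u i))%:R.
have Q0 i x : 0 <= Q i x by rewrite mulr_ge0 ?invr_ge0 ?ler0n.
have QE i (g : X -> R) : \sum_x Q i x * g x = M%:R^-1 * \sum_(x <- u i) g x.
  by rewrite -sum_count_mem mulr_sumr; apply: eq_bigr => x _; rewrite mulrA.
have Qd i : is_fdist (Q i).
  split=> //; transitivity (\sum_x Q i x * 1); first by apply: eq_bigr => x _; rewrite mulr1.
  by rewrite QE big_const_seq count_predT uM iter_addr_0 mulVf ?gt_eqF.
exists (@IdCode R X Y N Q (fun i => decoder (u i))); split=> //.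
- apply: bigmax_le => /= [|i _]; first by rewrite lee_fin; have := mean_hit_le1; lra.
  rewrite prob_outdist// lee_fin QE.
  have [_ rel _] := hL _ (uL i).
  under eq_bigr do rewrite prC//.
  rewrite sumrB big_const_seq count_predT uM iter_addr_0 mulrBr mulVf ?gt_eqF//.
  have : M%:R^-1 * \sum_(x <- u i) pr (W x) (T x) <=
         M%:R^-1 * \sum_(x <- u i) pr (W x) (decoder (u i)).
    rewrite ler_pM2l ?invr_gt0// !big_seq; apply: ler_sum => x xu.
    by apply: pr_mono => // y Ty; exists x.
  by move: rel; rewrite /reliable; lra.
- apply: bigmax_le => /= [|i _]; first by rewrite lee_fin ltW.
  apply: bigmax_le => /= [|j ji]; first by rewrite lee_fin ltW.
  rewrite prob_outdist// lee_fin QE.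
  suff : ~~ confusable (u i) (u j) by rewrite /confusable -leNgt.
  move/(pairwiseP [::]): pL => pL.
  have inN (k : 'I_N) : (k : nat) \in gtn (size L) by rewrite inE LN ltn_ord.
  move: ji; rewrite -val_eqE neq_ltn => /orP[lt_ji|lt_ij].
    by have /andP[] := pL _ _ (inN j) (inN i) lt_ji.
  by have /andP[] := pL _ _ (inN i) (inN j) lt_ij.
Qed.

End RandomIdentificationCode.

(** * The first inequalities *)

Lemma lee_of_lt_fin (R : realType) (x y : \bar R) :
  (forall a : R, (y < a%:E)%E -> (x <= a%:E)%E) -> (x <= y)%E.
Proof.
case: y => [r|_|h]; last 2 first.
- exact: leey.
- have {}h a : (x <= a%:E)%E by apply: h; exact: ltNyr.
  case: x h => [r h|/(_ 0)|]//.
  by have := h (r - 1); rewrite lee_fin lerDl oppr_ge0 ler10.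
by move=> h; apply: lee_add_pos => e e0; apply: h; rewrite lte_fin; lra.
Qed.

Lemma lee_of_fin_lt (R : realType) (x y : \bar R) :
  (forall a : R, (a%:E < x)%E -> (a%:E <= y)%E) -> (x <= y)%E.
Proof.
move=> h; rewrite -leeN2; apply: lee_of_lt_fin => a ya.
by rewrite leeNl -EFinN; apply: h; rewrite EFinN lteNl.
Qed.

Section Capacities.
Variables (R : realType) (X : nat -> finType) (Y : nat -> countType).
Variable W : forall n, X n -> Y n -> R.
Hypothesis W_ch : forall n, is_channel (W n).

Lemma id_mu_ge0 n (c : idcode R (X n) (Y n)) : (0 <= id_mu (W n) c)%E.
Proof. exact: bigmax_ge_id. Qed.

Definition trivial_idcode n (p : X n -> R) : idcode R (X n) (Y n) :=
  @IdCode R (X n) (Y n) 1 (fun=> p) (fun=> setT).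

Lemma trivial_idcode_code n (p : X n -> R) : is_fdist p -> is_idcode (trivial_idcode n p).
Proof. by move=> pd; split. Qed.

(* The rate of the one-message code is [0] because [ln] vanishes at [0]. *)
Lemma ID_cap_ge0 b (p : forall n, X n -> R) (mu : R) :
  (forall n, is_fdist (p n)) -> 0 <= mu -> (0 <= ID_cap (Lim b) W mu 0)%E.
Proof.
move=> pd mu0; apply: ereal_sup_ubound; exists (fun n => trivial_idcode n (p n)).
have mu_triv n : id_mu (W n) (trivial_idcode n (p n)) = 0%E.
  apply/eqP; rewrite eq_le id_mu_ge0 andbT; apply: bigmax_le => //= i _.
  by rewrite setCT /prob esum_set0.
have Lmu : Lim b (fun n => id_mu (W n) (trivial_idcode n (p n))) = 0%E.
  apply/eqP; rewrite eq_le; apply/andP; split; last exact: Lim_ge0 (fun n => id_mu_ge0 n _).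
  by apply/Lim_le/often_all => n; rewrite mu_triv.
split; first by move=> n; exact: trivial_idcode_code.
split; first by case: eqP => // /eqP mu_neq0; rewrite Lmu lte_fin lt_neqAle eq_sym mu_neq0.
split.
  apply: limn_esup_le; exists 0%N => n _; apply: bigmax_le => //= i _.
  by apply: bigmax_le => //= j; rewrite (ord1 i) (ord1 j).
have -> : (fun n => idrate R n (idN (trivial_idcode n (p n)))) = (fun=> 0%E).
  by apply/funext => n; rewrite /idrate /= ln1 ln0// mulr0.
apply/eqP; rewrite eq_le (@Lim_le _ false) ?limn_einf_ge//; first exact: (@often_all true).
exact: (@often_all false).
Qed.

(** The random code is used with [s = n%:R * g] and [tau = 2 / s]. Taking [M] near
    [expR (n%:R * (a - g))] gives [M%:R * K * expR s <= 1], and another loss of [g] in the exponent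
    leaves room for doubly exponentially many messages. *)
Lemma exists_idcodes (p : forall n, X n -> R) (a g : R) :
  (forall n, is_fdist (p n)) -> 0 < g -> 0 < a - 2 * g ->
  exists c : forall n, idcode R (X n) (Y n), (forall n, is_idcode (c n)) /\
    eventually (fun n => [/\
      (id_mu (W n) (c n) <= (1 - tail (W n) (p n) n a + 2 / (n%:R * g))%:E)%E,
      (id_lambda (W n) (c n) <= (2 / (n%:R * g))%:E)%E &
      ((a - 2 * g)%:E <= idrate R n (idN (c n)))%E]).
Proof.
move=> pd g0 ag; set b := a - 2 * g.
have [n0 h0] := eventually_natr_ge R (40 / g).
suff H n : exists c : idcode R (X n) (Y n), is_idcode c /\ ((n0 <= n)%N -> [/\
      (id_mu (W n) c <= (1 - tail (W n) (p n) n a + 2 / (n%:R * g))%:E)%E,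
      (id_lambda (W n) c <= (2 / (n%:R * g))%:E)%E &
      (b%:E <= idrate R n (idN c))%E]).
  exists (fun n => projT1 (cid (H n))); split=> [n|]; first by case: (projT2 (cid (H n))).
  by exists n0 => n nn0; case: (projT2 (cid (H n))) => _; exact.
have [nn0|] := leqP n0 n; last first.
  move=> _; exists (trivial_idcode n (p n)); split; first exact: trivial_idcode_code.
  done.
have ng : 40 <= n%:R * g by rewrite -ler_pdivrMr// h0.
have n_gt0 : 0 < n%:R :> R by rewrite -(pmulr_lgt0 _ g0); lra.
have nn_gt0 : (0 < n)%N by rewrite -(ltr_nat R).
have nb : 0 < n%:R * b by rewrite mulr_gt0.
pose t := n%:R * g; rewrite -/t in ng.
pose E := expR (n%:R * b).
have E1 : 1 <= E by rewrite -expR0 ler_expR ltW.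
(* The margin of [M] over [E]: it puts [M%:R / 2] above [E + 5 * t], which pays for the
   [2 * N%:R + 1] exclusions and for the tolerance [t^-1]. *)
have et : 10 * t + 5 <= expR t.
  have t0 : 0 <= t by lra.
  apply: (le_trans _ (expR_ge1Dxn 1 t0)).
  have -> : (2`!)%:R = 2 :> R by [].
  by rewrite expr2; nra.
have expE : expR (n%:R * (a - g)) = E * expR t.
  by rewrite -expRD; congr expR; rewrite /t /b; ring.
pose M := Num.trunc (expR (n%:R * (a - g))).
(* The successor ensures [E <= ln N%:R], so truncation costs no rate. *)
pose N := (Num.trunc (expR E)).+1.
have MltE : E * expR t < M%:R + 1 by rewrite -expE natr1; exact: truncnS_gt.
have MleE : M%:R <= expR (n%:R * (a - g)) by rewrite truncn_le expR_ge0.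
have M1 : (0 < M)%N by rewrite truncn_gt0 expE; nra.
have NleE : N%:R <= 2 * expR E.
  rewrite /N -(natr1 (Num.trunc (expR E))).
  have : (Num.trunc (expR E))%:R <= expR E by rewrite truncn_le expR_ge0.
  have : 1 <= expR E by rewrite -expR0 ler_expR; lra.
  lra.
have [|||||||c [c1 c2 c3 c4]] := @exists_idcode R (X n) (Y n) (W n) (p n)
    (infoset (W n) (p n) n a) M (expR (n%:R * a))^-1 t (2 / t) (W_ch n) (pd n) M1 _ _ _ _ _ N.
- by move=> x; apply: pr_outdist_infoset => //; lra.
- by rewrite /t mulr_ge0// ltW.
- rewrite mulrAC ler_pdivrMr ?expR_gt0// mul1r.
  have -> : n%:R * a = n%:R * (a - g) + t by rewrite /t; ring.
  by rewrite expRD ler_pM2r ?expR_gt0.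
- by rewrite divr_gt0//=; [rewrite ler_pdivrMr; lra|lra].
- by rewrite mulrC divfK// gt_eqF//; lra.
- by [].
- have -> : 2 / t / 2 = t^-1 by field; rewrite gt_eqF//; lra.
  rewrite -[ltRHS]mulr1 ltr_pdivlMl; last by lra.
  rewrite mulNr expRN mulrA ltr_pdivrMr ?expR_gt0// mul1r.
  have e1 : 1 <= expR E by rewrite -expR0 ler_expR; lra.
  apply: (@le_lt_trans _ _ (5 * t * expR E)); first nra.
  apply: (@le_lt_trans _ _ (expR (5 * t) * expR E)).
    rewrite ler_pM2r ?expR_gt0//; have := expR_ge1Dx (5 * t); lra.
  by rewrite -expRD ltr_expR; nra.
exists c; split=> // _; split=> //; rewrite c2 lee_fin ler_pdivlMl//.
have EN : E <= ln (N%:R : R).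
  by rewrite -[leLHS]expRK ler_ln ?posrE ?expR_gt0 ?ltr0n// ltW// truncnS_gt.
by rewrite -[leLHS]expRK ler_ln// posrE ?expR_gt0// (lt_le_trans (expR_gt0 _) EN).
Qed.

(** The first error is about 1 minus the tail, which exchanges limsup and liminf: hence [~~ b]. A
    threshold below the information quantity is inadmissible, so its tail stays large. *)
Lemma I_cap_le_ID_cap b (p : forall n, X n -> R) (eps : R) :
  (forall n, is_fdist (p n)) -> 0 <= eps <= 1 ->
  (I_cap (Lim (~~ b)) W p eps <= ID_cap (Lim b) W (1 - eps) 0)%E.
Proof.
move=> pd /andP[e0 e1]; apply: lee_of_fin_lt => a aI.
have D0 : (0 <= ID_cap (Lim b) W (1 - eps) 0)%E.
  by apply: (ID_cap_ge0 _ p) => //; rewrite subr_ge0.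
(* The construction needs a positive threshold; the one-message code covers the rest. *)
have [a0|a0] := leP a 0; first by apply: le_trans D0; rewrite lee_fin.
(* For [eps < 1] the tail beats [eps] with a gap. At [eps = 1] admissibility is strict, so only
   levels below 1 are beaten, which matches the requirement that the limit of the first error be
   0. *)
have tails : forall d : R, d < eps \/ (eps < 1 /\ d = eps) ->
    exists2 c, d < c & often b (fun n => c <= tail (W n) (p n) n a).
  move=> d hd; have : (d%:E < Lim (~~ b) (fun n => info_tail (W n) (p n) n a))%E.
    rewrite ltNge; apply/negP => Ld; move: aI; rewrite ltNge => /negP; apply.
    apply: ereal_inf_lbound; exists a => //=.
    case: hd => [de|[lt1 de]]; last by rewrite lt_eqF// -de.
    case: eqP => [eps1|_]; first by apply: (le_lt_trans Ld); rewrite lte_fin -eps1.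
    by apply: (le_trans Ld); rewrite lee_fin ltW.
  move=> /Lim_gt[c dc oc]; exists c => //; apply: often_impl oc => n.
  by rewrite info_tailE// lee_fin.
apply/lee_addgt0Pr => e e_gt0; rewrite -leeBlDr//.
pose g := Num.min (e / 2) (a / 4).
have g0 : 0 < g by rewrite lt_min; apply/andP; split; lra.
have ge2 : 2 * g <= e by rewrite mulrC -ler_pdivlMr// ge_min lexx.
have ga : 0 < a - 2 * g.
  by have : g <= a / 4; [rewrite ge_min lexx orbT|lra].
have [c [cc evc]] := exists_idcodes p a g pd g0 ga.
have ev_small (d : R) : 0 < d -> eventually (fun n => 2 / (n%:R * g) <= d).
  move=> d0; have [n0 h0] := eventually_natr_ge R (1 + 2 / (d * g)); exists n0 => n /h0 h.
  have dg : 0 < d * g by rewrite mulr_gt0.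
  have n_gt0 : 0 < n%:R :> R by apply: lt_le_trans h; rewrite addr_gt0// divr_gt0.
  rewrite ler_pdivrMr ?mulr_gt0// mulrCA -ler_pdivrMr//; lra.
have mu_le d c' : 0 < d -> often b (fun n => c' <= tail (W n) (p n) n a) ->
    (Lim b (fun n => id_mu (W n) (c n)) <= (1 - c' + d)%:E)%E.
  move=> d0 oc; apply: Lim_le.
  have := often_and _ _ _ oc (eventually_and _ _ evc (ev_small d d0)).
  apply: often_impl => n [ct [[hm _ _] sm]]; apply: (le_trans hm).
  by rewrite lee_fin; lra.
apply: (@le_trans _ _ (limn_einf (fun n => idrate R n (idN (c n))))).
  apply: limn_einf_ge; have [n0 h0] := evc; exists n0 => n /h0[_ _].
  by apply: le_trans; rewrite -EFinB lee_fin; lra.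
apply: ereal_sup_ubound; exists c; split=> //; split; [|split=> //].
- case: eqP => [eps1|/eqP eps1].
    apply/eqP; rewrite eq_le Lim_ge0 ?andbT; last by move=> n; exact: id_mu_ge0.
    apply: lee_add_pos => d d0; rewrite add0r.
    have [|c' c'd oc] := tails (1 - d / 2); first by left; lra.
    by apply: (le_trans (mu_le (d / 2) _ _ oc)); [lra|rewrite lee_fin; lra].
  have [|c' c'd oc] := tails eps.
    by right; split=> //; rewrite lt_neqAle e1 andbT -subr_eq0 -oppr_eq0 opprB.
  apply: (le_lt_trans (mu_le ((c' - eps) / 2) _ _ oc)); first lra.
  by rewrite lte_fin; lra.
- apply: lee_add_pos => d d0; rewrite add0r; apply: limn_esup_le.
  have [n0 h0] := eventually_and _ _ evc (ev_small d d0).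
  by exists n0 => n /h0[[_ hl _] sm]; apply: (le_trans hl); rewrite lee_fin.
Qed.

(** * The middle inequalities *)

Lemma ID_cap_le_Res_cap b (d : nat) (eps : R) : (0 < d)%N ->
  (forall n, #|X n| = (d ^ n)%N) -> 0 <= eps < 1 ->
  (ID_cap (Lim b) W (1 - eps) 0 <= Res_cap (Lim (~~ b)) W eps)%E.
Proof.
move=> d0 cardX /andP[e0 e1]; apply: ge_ereal_sup => _ [c [cc [hmu [hlam ->]]]].
apply: le_ereal_inf_tmp => _ [r hr <-].
move: hmu; rewrite gt_eqF ?subr_gt0// => /Lim_lt[m m1 om].
move: hr; rewrite lt_eqF; last by lra.
(* One third of the gap goes to the resolvability error and one to the second error. *)
pose h := (1 - eps - m) / 3; have h0 : 0 < h by rewrite /h; lra.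
move=> hr; have /Lim_lt[e ee oe] :
    (Lim (~~ b) (fun n => eps_res (W n) (expR (n%:R * r))) < (eps + h)%:E)%E.
  by apply: (le_lt_trans hr); rewrite lte_fin; lra.
have el : eventually (fun n => (id_lambda (W n) (c n) < h%:E)%E).
  by apply: limn_esup_lt; apply: le_lt_trans hlam _; rewrite lte_fin.
have fr : frequently (fun n => 1 <= expR (n%:R * r) /\
    (idN (c n) <= (d ^ n).+1 ^ Num.trunc (expR (n%:R * r)))%N).
  have := @often_and false _ _ (often_dual _ _ _ om oe) el.
  apply: (@often_impl false) => n [[hm he] hl]; rewrite -cardX.
  apply: (idcode_size_le _ _ _ _ (W_ch n) _ (cc n) m h (eps + h)) => //; first exact: ltW.
    by apply: le_lt_trans he _; rewrite lte_fin; lra.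
  by rewrite /h; lra.
(* For negative [r] the size bound drops below 1 and admits no code at all. *)
have r0 : 0 <= r.
  have [n n1 [+ _]] := fr 1%N.
  by rewrite -[leLHS]expR0 ler_expR pmulr_rge0// ltr0n.
apply: lee_add_pos => g g0; apply: (@Lim_le _ false).
have := @often_and false _ _ fr (idrate_le _ _ _ _ d0 r0 g0).
by apply: (@often_impl false) => n [[_ hN] hrate]; apply: hrate => //; case: (cc n).
Qed.

(** * The last inequalities *)

Lemma tail_mono n (p : X n -> R) (a a' : R) : is_fdist p -> a <= a' ->
  tail (W n) p n a' <= tail (W n) p n a.
Proof.
move=> [p0 _] aa; apply: ler_sum => x _; rewrite ler_wpM2l//.
apply: (pr_mono _ _ _ (W_ch n x)) => y.
exact: le_lt_trans.
Qed.

Lemma tail_frequently_lt1 (p : forall n, X n -> R) (a c : R) :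
  (forall n, is_fdist (p n)) -> c < 1 ->
  frequently (fun n => tail (W n) (p n) n a <= c) -> 0 <= a.
Proof.
move=> pd c1 fr; rewrite leNgt; apply/negP => a0.
have [n0 h0] := eventually_natr_ge R (1 + (1 - c)^-1 / (- a)).
have c0 : 0 < 1 - c by lra.
have na0 : 0 < - a by lra.
have [n nn0 tc] := fr n0; have hn := h0 _ nn0.
have n1 : (0 < n)%N.
  by rewrite -(ltr_nat R); apply: lt_le_trans hn; rewrite addr_gt0// divr_gt0// invr_gt0.
have := tail_ge _ _ _ (W n) (p n) n (W_ch n) (pd n) n1 a.
have : expR (n%:R * a) < 1 - c; last by lra.
rewrite -[n%:R * a]opprK expRN -[ltRHS]invrK ltf_pV2 ?posrE ?expR_gt0 ?invr_gt0//.
apply: (lt_le_trans _ (expR_ge1Dx _)).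
have : (1 - c)^-1 <= - (n%:R * a); last by lra.
by rewrite -mulrN -ler_pdivrMr//; lra.
Qed.

(** Resolvability must handle every input law at each [n]; one nearly maximising sequence reduces
    this to a single [p] in the supremum of the information quantities. *)
Lemma exists_worst_input (a : R) : (forall n, (0 < #|X n|)%N) ->
  exists p : forall n, X n -> R, (forall n, is_fdist (p n)) /\
    forall n (p' : X n -> R), is_fdist p' ->
      tail (W n) p' n a <= tail (W n) (p n) n a + n.+1%:R^-1.
Proof.
move=> X0.
suff H n : exists p : X n -> R, is_fdist p /\ forall p' : X n -> R, is_fdist p' ->
      tail (W n) p' n a <= tail (W n) p n a + n.+1%:R^-1.
  exists (fun n => projT1 (cid (H n))); split=> n; first by case: (projT2 (cid (H n))).
  by case: (projT2 (cid (H n))) => _; exact.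
pose A := [set tail (W n) p n a | p in [set p | is_fdist p]].
have supA : has_sup A.
  split; last by exists 1 => _ [p pd <-]; exact: tail_le1.
  have /card_gt0P[x _] := X0 n.
  exists (tail (W n) (fun z => (z == x)%:R) n a), (fun z => (z == x)%:R) => //.
  split=> [z|]; first exact: ler0n.
  by rewrite (bigD1 x)//= eqxx big1 ?addr0// => z /negbTE ->.
have n0 : 0 < n.+1%:R^-1 :> R by rewrite invr_gt0 ltr0n.
have [_ [p pd <-] hp] := sup_adherent n0 supA.
exists p; split=> // p' pd'; rewrite -lerBlDr; apply: le_trans (ltW hp).
by rewrite lerD2r; apply: sup_upper_bound => //; exists p'.
Qed.

Lemma eps_res_often_le b (p : forall n, X n -> R) (a a' c e : R) :
  (forall n (p' : X n -> R), is_fdist p' ->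
     tail (W n) p' n a' <= tail (W n) (p n) n a' + n.+1%:R^-1) ->
  0 <= a' -> a' < a -> 0 < e -> often b (fun n => tail (W n) (p n) n a' <= c) ->
  often b (fun n => (eps_res (W n) (expR (n%:R * a)) <= (2 * c + e)%:E)%E).
Proof.
move=> worst a'0 aa e0 oc.
have da : 0 < a - a' by lra.
(* The term [4 / e] makes the defect of [p] at most [e / 4], counted twice; [8 / e ^+ 2] makes the
   square root at most [e / 2], using that [M%:R + 1] is at most [2 * M%:R]. *)
have [n0 h0] := eventually_natr_ge R (1 + 4 / e + 8 / e ^+ 2 / (a - a')).
have e2 : 0 < e ^+ 2 by rewrite exprn_gt0.
have ev : eventually (fun n => [/\ (0 < n)%N, 4 / e <= n%:R & 8 / e ^+ 2 <= n%:R * (a - a')]).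
  exists n0 => n /h0 hn.
  have q1 : 0 <= 4 / e by rewrite divr_ge0// ltW.
  have q2 : 0 <= 8 / e ^+ 2 / (a - a') by rewrite !divr_ge0// ltW.
  split; last 1 first.
  - by rewrite -ler_pdivrMr//; lra.
  - by rewrite -(ltr_nat R); lra.
  - by lra.
have := often_and _ _ _ oc ev; apply: often_impl => n [tc [n1 n4 n8]].
apply: ge_ereal_sup => _ [p' [pd' ->]].
pose M := Num.trunc (expR (n%:R * a)).
have E1 : 1 <= expR (n%:R * a) by rewrite -expR0 ler_expR mulr_ge0 ?ler0n//; lra.
have M1 : (0 < M)%N by rewrite truncn_gt0.
have M1' : 1 <= M%:R :> R by rewrite ler1n.
have ME : expR (n%:R * a) < M%:R + 1 by rewrite natr1 truncnS_gt.
have [s sM hs] := exists_resolvability_code _ _ _ _ _ _ a' (W_ch n) pd' n1 M M1.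
apply: ge_ereal_inf; exists (res_err (W n) s (outdist (W n) p')).
  by exists s => //; rewrite /= sM; split=> //; rewrite truncn_le expR_ge0.
apply: (le_trans hs); rewrite lee_fin.
have n4' : n.+1%:R^-1 <= e / 4.
  rewrite -[leRHS]invrK lef_pV2 ?posrE ?ltr0n ?invr_gt0 ?divr_gt0// invf_div -natr1; lra.
have hp : tail (W n) p' n a' <= tail (W n) (p n) n a' + e / 4.
  by apply: (le_trans (worst n p' pd')); rewrite lerD2l.
suff : Num.sqrt (expR (n%:R * a') / M%:R) <= e / 2 by lra.
rewrite -[leRHS]ger0_norm; last by lra.
rewrite -sqrtr_sqr ler_wsqrtr// ler_pdivrMr; last by lra.
have Ed : expR (n%:R * a) = expR (n%:R * a') * expR (n%:R * (a - a')).
  by rewrite -expRD; congr expR; ring.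
have Eg : 8 / e ^+ 2 <= expR (n%:R * (a - a')).
  by apply: (le_trans _ (expR_ge1Dx _)); lra.
have := ler_wpM2l (expR_ge0 (n%:R * a')) Eg; rewrite -Ed mulrA ler_pdivrMr// => h8.
rewrite exprMn exprVn; have := ltr_pM2r e2 (expR (n%:R * a)) (M%:R + 1); rewrite ME => hM.
have : (M%:R + 1) * e ^+ 2 <= 2 * M%:R * e ^+ 2 by rewrite ler_pM2r//; lra.
lra.
Qed.

(** With [a'] strictly between the supremum and [a], the worst inputs at [a'] still have tail about
    [eps / 2]; the code error is twice the tail, and the gap [a - a'] removes the variance term. *)
Lemma Res_cap_le_supI b (eps : R) : (forall n, (0 < #|X n|)%N) -> 0 <= eps <= 2 ->
  (Res_cap (Lim b) W eps <= supI (@I_cap R (Lim b)) W (eps / 2))%E.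
Proof.
move=> X0 /andP[e0 e2]; apply: lee_of_lt_fin => a /lte_fin_dense[a' supa' a'a].
have [p [pd worst]] := exists_worst_input a' X0.
have [_ [a0 ha0 <-] a0a'] : exists2 x, [set a%:E | a in [set a : R |
    if eps / 2 == 1 then (Lim b (fun n => info_tail (W n) (p n) n a) < 1)%E
    else (Lim b (fun n => info_tail (W n) (p n) n a) <= (eps / 2)%:E)%E]] x & (x < a'%:E)%E.
  by apply: ereal_inf_lt; apply: le_lt_trans supa'; apply: ereal_sup_ubound; exists p.
rewrite lte_fin in a0a'.
have otail (c : R) : (Lim b (fun n => info_tail (W n) (p n) n a0) < c%:E)%E -> c <= 1 ->
    0 <= a' /\ exists2 c', c' < c & often b (fun n => tail (W n) (p n) n a' <= c').
  move=> /Lim_lt[c' c'c oc] c1.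
  have {}oc : often b (fun n => tail (W n) (p n) n a0 <= c').
    by apply: often_impl oc => n; rewrite info_tailE.
  split; last first.
    exists c' => //; apply: often_impl oc => n; apply: le_trans.
    exact: tail_mono (pd n) (ltW a0a').
  apply: le_trans (ltW a0a'); apply: (tail_frequently_lt1 p a0 c' pd); first exact: lt_le_trans c1.
  exact: often_frequently oc.
apply: ereal_inf_lbound; exists a => //=; move: ha0 => /=.
have -> : (eps / 2 == 1) = (eps == 2).
  by apply/eqP/eqP => [?|->]; [lra|rewrite divff].
case: eqP => [eps2|/eqP eps2] hL.
  have [a'0 [c c1 oc]] := otail 1 hL (lexx _).
  have d0 : 0 < 1 - c by lra.
  apply: (le_lt_trans (Lim_le _ _ _ _ (eps_res_often_le _ _ _ _ _ _ worst a'0 a'a d0 oc))).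
  by rewrite lte_fin; lra.
have {}eps2 : eps < 2 by rewrite lt_neqAle eps2.
apply: lee_add_pos => e e_gt0.
(* The second bound keeps the tail level at most 1, as [otail] requires to exclude a negative
   [a']. *)
pose h := Num.min (e / 4) (1 - eps / 2).
have h0 : 0 < h by rewrite lt_min; apply/andP; split; lra.
have he : h <= e / 4 by rewrite ge_min lexx.
have h1 : h <= 1 - eps / 2 by rewrite ge_min lexx orbT.
have [||a'0 [c c1 oc]] := otail (eps / 2 + h).
- by apply: (le_lt_trans hL); rewrite lte_fin; lra.
- by lra.
have e20 : 0 < e / 2 by lra.
apply: (le_trans (Lim_le _ _ _ _ (eps_res_often_le _ _ _ _ _ _ worst a'0 a'a e20 oc))).
by rewrite lee_fin; lra.
Qed.

End Capacities.

Theorem theorem4 (R : realType) (d : nat) (X : nat -> finType)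
  (Y : nat -> countType) (W : forall n, X n -> Y n -> R) :
  (0 < d)%N ->
  (forall n, #|X n| = (d ^ n)%N) ->
  (forall n, is_channel (W n)) ->
  (* first inequalities, 0 <= eps <= 1 *)
  (forall eps : R, 0 <= eps <= 1 ->
     (supI (@Ilow R) W eps <= Dcap W (1 - eps) 0)%E /\
     (supI (@Iup R) W eps <= Dcap_dag W (1 - eps) 0)%E) /\
  (* middle inequalities, 0 <= eps < 1 *)
  (forall eps : R, 0 <= eps < 1 ->
     (Dcap W (1 - eps) 0 <= Scap_dag W eps)%E /\
     (Dcap_dag W (1 - eps) 0 <= Scap W eps)%E) /\
  (* last inequalities, 0 <= eps <= 2 *)
  (forall eps : R, 0 <= eps <= 2 ->
     (Scap_dag W eps <= supI (@Ilow R) W (eps / 2))%E /\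
     (Scap W eps <= supI (@Iup R) W (eps / 2))%E) /\
  (* in particular *)
  (supI (@Ilow R) W 0 = Dcap W 1 0 /\ Dcap W 1 0 = Scap_dag W 0) /\
  (supI (@Iup R) W 0 = Dcap_dag W 1 0 /\ Dcap_dag W 1 0 = Scap W 0).
Proof.
move=> d0 cardX W_ch.
have X0 n : (0 < #|X n|)%N by rewrite cardX expn_gt0 d0.
have first_ineq (eps : R) : 0 <= eps <= 1 ->
    (supI (@Ilow R) W eps <= Dcap W (1 - eps) 0)%E /\
    (supI (@Iup R) W eps <= Dcap_dag W (1 - eps) 0)%E.
  move=> he; split; apply: ge_ereal_sup => _ [p pd <-].
  - exact: (I_cap_le_ID_cap _ _ _ _ W_ch true).
  - exact: (I_cap_le_ID_cap _ _ _ _ W_ch false).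
have middle_ineq (eps : R) : 0 <= eps < 1 ->
    (Dcap W (1 - eps) 0 <= Scap_dag W eps)%E /\
    (Dcap_dag W (1 - eps) 0 <= Scap W eps)%E.
  move=> he; split.
  - exact: (ID_cap_le_Res_cap _ _ _ _ W_ch true d).
  - exact: (ID_cap_le_Res_cap _ _ _ _ W_ch false d).
have last_ineq (eps : R) : 0 <= eps <= 2 ->
    (Scap_dag W eps <= supI (@Ilow R) W (eps / 2))%E /\
    (Scap W eps <= supI (@Iup R) W (eps / 2))%E.
  move=> he; split.
  - exact: (Res_cap_le_supI _ _ _ _ W_ch false).
  - exact: (Res_cap_le_supI _ _ _ _ W_ch true).
do 3 split=> //.
(* At 0 the levels [eps] and [eps / 2] coincide, so each chain closes into a cycle. *)
have [|i1 i2] := first_ineq 0; first by rewrite lexx ler01.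
have [|m1 m2] := middle_ineq 0; first by rewrite lexx ltr01.
have [|l1 l2] := last_ineq 0; first by rewrite lexx ler0n.
rewrite !subr0 in i1 i2 m1 m2; rewrite !mul0r in l1 l2.
by split; split; apply: le_anti; apply/andP; split=> //;
  [exact: le_trans m1 l1|exact: le_trans l1 i1|exact: le_trans m2 l2|exact: le_trans l2 i2].
Qed.
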